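(* Let $\rho_h$ be a (probabilistically weak) solution, as defined in the context, of the discontinuous Galerkin Dean--Kawasaki scheme with initial datum $\rho_{0,h}\in V_p$. Then the scheme conserves global mass: for all $t>0$, $$\mathrm d\int_{\mathbb T^d}\rho_h(t,\boldsymbol x)\,\mathrm d\boldsymbol x=0,$$ i.e. almost surely $\int_{\mathbb T^d}\rho_h(t,\boldsymbol x)\,\mathrm d\boldsymbol x=\int_{\mathbb T^d}\rho_{0,h}(\boldsymbol x)\,\mathrm d\boldsymbol x$ for all times $t$ in the interval on which $\rho_h$ is defined.
   Context: Let $d\in\{1,2,3\}$, $p\ge1$ an integer, $\mathbb T^d$ the flat torus; $(\cdot,\cdot)$ and $\|\cdot\|$ are the $L^2(\mathbb T^d)$ inner product and norm. $\mathcal T_h$ is a shape-regular, quasi-uniform affine simplicial mesh of $\mathbb T^d$ with facet set $\mathcal F_h$ (all facets interior by periodicity); $h_F>0$ is the diameter of $F$ (for $d=1$, a positive local length scale). $V_p$ (resp. $\boldsymbol V_\ell^d$) is the space of $L^2$ functions (resp. $\mathbb R^d$-valued functions) that are polynomials of degree at most $p$ (resp. $\ell$) on each element, without continuity. On $F=\partial K_\ell\cap\partial K_r$: $\{\!\{\boldsymbol v\}\!\}:=\frac12(\boldsymbol v|_{K_\ell}+\boldsymbol v|_{K_r})$, $[\![v]\!]:=v|_{K_\ell}\boldsymbol n_{K_\ell}+v|_{K_r}\boldsymbol n_{K_r}$. Local lifting $\boldsymbol{\mathcal L}_F(\boldsymbol u)\in\boldsymbol V_{p-1}^d$: $\int_{\mathbb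 T^d}\boldsymbol{\mathcal L}_F(\boldsymbol u)\cdot\boldsymbol v_h=\int_F\{\!\{\boldsymbol v_h\}\!\}\cdot\boldsymbol u\,\mathrm dS$ for all $\boldsymbol v_h\in\boldsymbol V_{p-1}^d$. Discrete gradient $G_hv_h:=\nabla_hv_h-\sum_F\boldsymbol{\mathcal L}_F([\![v_h]\!])$, $\nabla_h$ the elementwise gradient. Symmetric interior penalty form with $\eta>0$: $$a_h(w_h,v_h):=\tfrac12(\nabla_hw_h,\nabla_hv_h)-\tfrac12\sum_{F}\int_F\big([\![w_h]\!]\cdot\{\!\{\nabla_hv_h\}\!\}+\{\!\{\nabla_hw_h\}\!\}\cdot[\![v_h]\!]\big)\mathrm dS+\tfrac\eta2\sum_Fh_F^{-1}\int_F[\![w_h]\!]\cdot[\![v_h]\!]\,\mathrm dS.$$ Scheme. Let $n_G:=\dim\boldsymbol V_{p-1}^d$, $\{\boldsymbol f_i\}$ a basis of $\boldsymbol V_{p-1}^d$, $(M_{\mathrm G})_{ij}=(\boldsymbol f_i,\boldsymbol f_j)$, $u_h^+=\max\{u_h,0\}$, $P(u_h)_{ij}=\int u_h^+\boldsymbol f_i\cdot\boldsymbol f_j$, $R(u_h)=P(u_h)^{1/2}$ (symmetric positive semi-definite root), $\boldsymbol g_j(u_h):=\sum_i(M_{\mathrm G}^{-1}R(u_h))_{ij}\boldsymbol f_i$. A weak solution on $[0,T]$ is a filtered probability space with an $n_G$-dimensional standard Brownian motion $(B_j)$ and a continuous adapted $V_p$-valued process $\rho_h$ with $(\rho_h(t),v_h)=(\rho_{0,h},v_h)-\int_0^ta_h(\rho_h(s),v_h)\mathrm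 ds+N^{-1/2}\sum_j\int_0^t(\boldsymbol g_j(\rho_h(s)),G_hv_h)\mathrm dB_j(s)$ for all $v_h\in V_p$, $t\in[0,T]$, a.s., and $\mathbb E[\sup_{t\le T}\|\rho_h(t)\|^q]<\infty$ for all $q\ge2$. *)

(* Defs.v *)
From HB Require Import structures.
From mathcomp Require Import all_boot all_order all_algebra.
(* mpoly comes before MathComp-Analysis, whose notations and whose [isMeasure]
   it would otherwise shadow *)
From mathcomp Require Import -(notations) mpoly.
From mathcomp Require Import all_classical all_reals all_analysis.

Set Implicit Arguments.
Unset Strict Implicit.
Unset Printing Implicit Defensive.

Import Order.TTheory GRing.Theory Num.Theory.
Import numFieldNormedType.Exports.

Local Open Scope classical_set_scope.
Local Open Scope ring_scope.

Section LebesgueSucc.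
Context (R : realType) (n : nat).
Local Notation rT := (measurableTypeR R).

Definition tcons (x : rT * n.-tuple rT) : n.+1.-tuple rT := [tuple of x.1 :: x.2].
Definition tuncons (x : n.+1.-tuple rT) : rT * n.-tuple rT :=
  (thead x, [tuple of behead x]).

Lemma measurable_tcons : measurable_fun [set: rT * n.-tuple rT] tcons.
Proof. exact: measurable_cons measurable_fst measurable_snd. Qed.

Lemma measurable_tuncons : measurable_fun [set: n.+1.-tuple rT] tuncons.
Proof.
apply/measurable_fun_pairP; split; first exact: measurable_tnth.
exact: measurable_behead.
Qed.

Lemma tconsK : cancel tcons tuncons.
Proof. by case=> x y; congr pair; apply: val_inj. Qed.

Variable mu : {sigma_finite_measure set (n.-tuple rT) -> \bar R}.

(* the image of the product measure on R * R^n under R * R^n = R^n.+1 *)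
Definition lebesgue_succ : set (n.+1.-tuple rT) -> \bar R :=
  pushforward (@lebesgue_measure R \x mu)%E tcons.

Let lebesgue_succ0 : lebesgue_succ set0 = 0%E.
Proof. by rewrite /lebesgue_succ /pushforward preimage_set0 measure0. Qed.

Let lebesgue_succ_ge0 A : (0 <= lebesgue_succ A)%E.
Proof. by rewrite /lebesgue_succ /pushforward measure_ge0. Qed.

Let mpre A : measurable A -> measurable (tcons @^-1` A).
Proof. by move=> mA; rewrite -[X in measurable X]setTI; exact: measurable_tcons. Qed.

Let lebesgue_succ_sigma_additive : semi_sigma_additive lebesgue_succ.
Proof.
move=> F mF tF mUF; rewrite /lebesgue_succ /pushforward preimage_bigcup.
apply: measure_semi_sigma_additive.
- by move=> i; exact: mpre.
- apply/trivIsetP => /= i j _ _ ij; rewrite -preimage_setI.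
  by move/trivIsetP : tF => /(_ _ _ _ _ ij) ->//; rewrite preimage_set0.
- by rewrite -preimage_bigcup; exact: mpre.
Qed.

HB.instance Definition _ := isMeasure.Build _ _ _ lebesgue_succ
  lebesgue_succ0 lebesgue_succ_ge0 lebesgue_succ_sigma_additive.

Let lebesgue_succ_sigma_finite : sigma_finite setT lebesgue_succ.
Proof.
have /sigma_finiteP[F [TF ndF Foo]] := sigma_finiteT (@lebesgue_measure R).
have /sigma_finiteP[G [TG ndG Goo]] := sigma_finiteT mu.
exists (fun i => tuncons @^-1` (F i `*` G i)).
  rewrite -preimage_bigcup -[LHS](preimage_setT tuncons); congr (_ @^-1` _).
  rewrite -setXTT TF TG predeqE => -[x y]; split.
    move=> [/= [i _ Fx] [k _ Gy]]; exists (maxn i k) => //; split.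
    - by move: x Fx; exact/subsetPset/ndF/leq_maxl.
    - by move: y Gy; exact/subsetPset/ndG/leq_maxr.
  by move=> [i _ []/= ? ?]; split; exists i.
move=> i; have [mF Fi] := Foo i; have [mG Gi] := Goo i; split.
  rewrite -[X in measurable X]setTI; apply: measurable_tuncons => //.
  exact: measurableX.
rewrite /lebesgue_succ /pushforward -comp_preimage.
rewrite (_ : tuncons \o tcons = id); last by apply/funext => x /=; rewrite tconsK.
by rewrite preimage_id product_measure1E// lte_mul_pinfty// ge0_fin_numE.
Qed.

HB.instance Definition _ := Measure_isSigmaFinite.Build _ _ _ lebesgue_succ
  lebesgue_succ_sigma_finite.

End LebesgueSucc.

(* Lebesgue measure on R^n *)
Fixpoint lebesgue_Rn (R : realType) (n : nat) :
    {sigma_finite_measure set (n.-tuple (measurableTypeR R)) -> \bar R} :=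
  if n is k.+1 then lebesgue_succ (lebesgue_Rn R k) else \d_([tuple]).

Section Geometry.
Context (R : realType).

Definition rV_of_tuple n (x : n.-tuple (measurableTypeR R)) : 'rV[R]_n :=
  \row_i tnth x i.

Definition vol_int n (K : set 'rV[R]_n) (f : 'rV[R]_n -> R) : R :=
  \int[lebesgue_Rn R n]_(x in [set x | K (rV_of_tuple x)]) f (rV_of_tuple x).

(* The library norm on row vectors is the sup norm. *)
Definition dot n (x y : 'rV[R]_n) : R := \sum_i x 0 i * y 0 i.
Definition enorm n (x : 'rV[R]_n) : R := Num.sqrt (dot x x).

Definition diam n (A : set 'rV[R]_n) : R :=
  sup [set r | exists x y, [/\ A x, A y & r = enorm (x - y)]].

Definition inball_diam n (A : set 'rV[R]_n) : R :=
  sup [set r | 0 <= r /\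
    exists x, [set y | enorm (y - x) <= r / 2] `<=` A].

Definition hull n m (a : 'I_m -> 'rV[R]_n) (J : set 'I_m) : set 'rV[R]_n :=
  [set x | exists w : 'I_m -> R,
    [/\ forall i, 0 <= w i, forall i, ~ J i -> w i = 0,
        \sum_i w i = 1 & x = \sum_i w i *: a i]].

Definition ref_simplex n : set 'rV[R]_n :=
  [set s | (forall i, 0 <= s 0 i) /\ \sum_i s 0 i <= 1].

Definition edges n k (b : 'I_k.+1 -> 'rV[R]_n) : 'M[R]_(k, n) :=
  \matrix_i (b (lift ord0 i) - b ord0).

(* k-dimensional surface integral over the simplex with vertices b, through
   its affine parametrization; for k = 0 it is evaluation at the point b 0. *)
Definition surf_int n k (b : 'I_k.+1 -> 'rV[R]_n) (f : 'rV[R]_n -> R) : R :=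
  Num.sqrt (\det (edges b *m (edges b)^T)) *
  vol_int (@ref_simplex k) (fun s => f (b ord0 + s *m edges b)).

(* The direction c below solves (a_j - a_i) . c = 1 for all j <> i, that is, c
   is orthogonal to the face opposite to a_i and points from a_i to it. *)
Definition outward_normal n (a : 'I_n.+1 -> 'rV[R]_n) (i : 'I_n.+1) : 'rV[R]_n :=
  let A := \matrix_(j < n) (a (lift i j) - a i) in
  let c := (invmx A *m const_mx 1)^T in
  (enorm c)^-1 *: c.

End Geometry.

(* A simplicial mesh of the torus R^d / (period Z)^d, d = n.+1, given by one
   representative in R^d of each element.  The facet opposite to vertex i of
   the element K is [(K, i)].  A facet F of the torus has two sides
   [side F false] and [side F true]; the face of the former is the face of the
   latter translated by [shift F]. *)
Record mesh (R : realType) (n : nat) := Mesh {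
  period : R;
  elt : finType;
  facet : finType;
  vtx : elt -> 'I_n.+2 -> 'rV[R]_n.+1;
  side : facet -> bool -> elt * 'I_n.+2;
  zshift : facet -> 'rV[int]_n.+1 }.

Section Mesh.
Context (R : realType) (n : nat) (M : mesh R n).
Local Notation d := n.+1.

Definition lattice (z : 'rV[int]_d) : 'rV[R]_d :=
  period M *: map_mx (fun k : int => k%:~R) z.

Definition shift (F : facet M) : 'rV[R]_d := lattice (zshift F).

Definition simplex (K : elt M) : set 'rV[R]_d := hull (vtx K) setT.

Definition face_set (Ki : elt M * 'I_d.+1) : set 'rV[R]_d :=
  hull (vtx Ki.1) [set j | j != Ki.2].

Definition facet_set (F : facet M) := face_set (side F false).

Definition face_vertices (Ki : elt M * 'I_d.+1) : set 'rV[R]_d :=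
  [set vtx Ki.1 j | j in [set j : 'I_d.+1 | j != Ki.2]].

(* Two translates of elements meet in the hull of their common vertices, and
   distinct translates have distinct vertex sets. *)
Definition conforming : Prop :=
  (forall (K K' : elt M) z x, simplex K x -> simplex K' (x - lattice z) ->
     hull (vtx K) [set i | exists j, vtx K i = vtx K' j + lattice z] x) /\
  (forall (K K' : elt M) z,
     range (vtx K) = [set vtx K' j + lattice z | j in [set: 'I_d.+1]] ->
     K = K' /\ z = 0).

(* Every face of every element is exactly one side of exactly one facet. *)
Definition facets_match : Prop :=
  bijective (fun Fb : facet M * bool => side Fb.1 Fb.2) /\
  (forall F : facet M, face_vertices (side F false) =
     [set y + shift F | y in face_vertices (side F true)]).

Definition is_mesh : Prop :=
  [/\ 0 < period M,
      forall K : elt M, row_free (edges (vtx K)),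
      forall x, exists (K : elt M) z, simplex K (x - lattice z),
      conforming &
      facets_match].

Definition shape_regular (sigma : R) : Prop :=
  forall K, diam (simplex K) <= sigma * inball_diam (simplex K).

Definition quasi_uniform (tau : R) : Prop :=
  forall K K', diam (simplex K) <= tau * diam (simplex K').

(* h_F; it is an arbitrary positive length in dimension one. *)
Definition facet_length (hF : facet M -> R) : Prop :=
  forall F, (n = 0%N -> 0 < hF F) /\ ((0 < n)%N -> hF F = diam (facet_set F)).

(* Elementwise polynomial functions on the torus.  The polynomial of K is
   expressed in the coordinates of the representative of K. *)
Definition bscal : Type := {ffun elt M -> mpoly d R}.
Definition bvect : Type := {ffun elt M -> {ffun 'I_d -> mpoly d R}}.

Definition Vscal (l : nat) (v : bscal) : Prop :=
  forall K, (msize (v K) <= l.+1)%N.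
Definition Vvect (l : nat) (v : bvect) : Prop :=
  forall K i, (msize (v K i) <= l.+1)%N.

Definition peval (q : mpoly d R) (x : 'rV[R]_d) : R := meval (x 0) q.
Definition seval (v : bscal) (K : elt M) (x : 'rV[R]_d) : R := peval (v K) x.
Definition veval (v : bvect) (K : elt M) (x : 'rV[R]_d) : 'rV[R]_d :=
  \row_i peval (v K i) x.

(* Integral over the torus of the function equal to [f K] on each element K. *)
Definition torus_int (f : elt M -> 'rV[R]_d -> R) : R :=
  \sum_K vol_int (simplex K) (f K).

Definition sinner (u v : bscal) : R :=
  torus_int (fun K x => seval u K x * seval v K x).
Definition vinner (u v : bvect) : R :=
  torus_int (fun K x => dot (veval u K x) (veval v K x)).
Definition snorm (u : bscal) : R := Num.sqrt (sinner u u).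

Definition grad (v : bscal) : bvect := [ffun K => [ffun i => mderiv i (v K)]].

Definition facet_int (F : facet M) (f : 'rV[R]_d -> R) : R :=
  surf_int (fun j => vtx (side F false).1 (lift (side F false).2 j)) f.

(* Point of the representative of the element on side b that corresponds to
   the point x of [facet_set F]. *)
Definition side_pt (F : facet M) (b : bool) (x : 'rV[R]_d) : 'rV[R]_d :=
  if b then x - shift F else x.

Definition strace (F : facet M) b (v : bscal) x : R :=
  seval v (side F b).1 (side_pt F b x).
Definition vtrace (F : facet M) b (v : bvect) x : 'rV[R]_d :=
  veval v (side F b).1 (side_pt F b x).
Definition normal (F : facet M) b : 'rV[R]_d :=
  outward_normal (vtx (side F b).1) (side F b).2.

Definition avg (F : facet M) (v : bvect) (x : 'rV[R]_d) : 'rV[R]_d :=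
  2^-1 *: (vtrace F false v x + vtrace F true v x).
Definition jump (F : facet M) (v : bscal) (x : 'rV[R]_d) : 'rV[R]_d :=
  strace F false v x *: normal F false + strace F true v x *: normal F true.

Definition is_lifting (l : nat) (F : facet M) (u : 'rV[R]_d -> 'rV[R]_d)
    (L : bvect) : Prop :=
  Vvect l L /\ forall v, Vvect l v ->
    vinner L v = facet_int F (fun x => dot (avg F v x) (u x)).

(* the L^2 Riesz representative: there is exactly one lifting *)
Definition lifting (l : nat) (F : facet M) (u : 'rV[R]_d -> 'rV[R]_d) : bvect :=
  xget 0 [set L | is_lifting l F u L].

(* the discrete gradient G_h *)
Definition dgrad (p : nat) (v : bscal) : bvect :=
  grad v - \sum_F lifting p.-1 F (jump F v).

Definition sip_form (eta : R) (hF : facet M -> R) (w v : bscal) : R :=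
  2^-1 * vinner (grad w) (grad v)
  - 2^-1 * \sum_F facet_int F (fun x =>
      dot (jump F w x) (avg F (grad v) x) + dot (avg F (grad w) x) (jump F v x))
  + eta / 2 * \sum_F (hF F)^-1 *
      facet_int F (fun x => dot (jump F w x) (jump F v x)).

Definition is_basis (l nG : nat) (f : 'I_nG -> bvect) : Prop :=
  (forall i, Vvect l (f i)) /\
  (forall v, Vvect l v ->
     exists! c : 'rV[R]_nG, v = \sum_i c 0 i *: f i).

Definition psd m (A : 'M[R]_m) : Prop :=
  A^T = A /\ forall x : 'rV[R]_m, 0 <= (x *m A *m x^T) 0 0.

(* every psd matrix has exactly one psd square root *)
Definition psd_sqrt m (A : 'M[R]_m) : 'M[R]_m :=
  xget 0 [set S | psd S /\ S *m S = A].

Definition gram nG (f : 'I_nG -> bvect) : 'M[R]_nG :=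
  \matrix_(i, j) vinner (f i) (f j).

Definition weighted_gram nG (f : 'I_nG -> bvect) (u : bscal) : 'M[R]_nG :=
  \matrix_(i, j) torus_int (fun K x =>
    Num.max (seval u K x) 0 * dot (veval (f i) K x) (veval (f j) K x)).

(* g_j(u) *)
Definition noise_field nG (f : 'I_nG -> bvect) (u : bscal) (j : 'I_nG) : bvect :=
  \sum_i (invmx (gram f) *m psd_sqrt (weighted_gram f u)) i j *: f i.

End Mesh.

Section Stochastic.
Context (R : realType) (dO : measure_display) (Omega : measurableType dO).
Variables (P : probability Omega R) (T : R) (Filt : R -> set (set Omega)).

Definition is_filtration : Prop :=
  (forall t, 0 <= t <= T ->
     sigma_algebra setT (Filt t) /\ Filt t `<=` measurable) /\
  (forall s t, 0 <= s -> s <= t -> t <= T -> Filt s `<=` Filt t).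

Definition measurable_at (t : R) (X : Omega -> R) : Prop :=
  forall C : set (measurableTypeR R), measurable C -> Filt t (X @^-1` C).

(* m-dimensional standard Brownian motion on [0, T] relative to Filt: the
   increments after time s are independent of Filt s, and their components are
   independent centred Gaussians; [normal_prob] takes the standard deviation. *)
Definition is_brownian m (B : 'I_m -> R -> Omega -> R) : Prop :=
  [/\ forall j, {ae P, forall w, B j 0 w = 0},
      forall j, {ae P, forall w, {within `[0, T], continuous (B j ^~ w)}},
      forall j t, 0 <= t <= T -> measurable_at t (B j t) &
      forall s t A (C : 'I_m -> set (measurableTypeR R)),
        0 <= s -> s < t -> t <= T -> Filt s A -> (forall j, measurable (C j)) ->
        P (A `&` [set w | forall j, C j (B j t w - B j s w)]) =
        (P A * \prod_j normal_prob 0 (Num.sqrt (t - s)) (C j))%E].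

(* Elementary process \sum_k xi_k 1_(]t_k, t_k.+1]) on [0, t]. *)
Record elementary := Elementary {
  nsteps : nat;
  knot : nat -> R;
  coef : nat -> Omega -> R }.

Definition is_elementary (t : R) (e : elementary) : Prop :=
  [/\ knot e 0 = 0, knot e (nsteps e) = t,
      forall k, (k < nsteps e)%N -> knot e k <= knot e k.+1 &
      forall k, (k < nsteps e)%N -> measurable_at (knot e k) (coef e k) /\
        exists c : R, forall w, `|coef e k w| <= c].

Definition elementary_val (e : elementary) (s : R) (w : Omega) : R :=
  \sum_(k < nsteps e)
    coef e k w * \1_(`]knot e k, knot e k.+1] : set R) s.

Definition elementary_int (b : R -> Omega -> R) (e : elementary) (w : Omega) : R :=
  \sum_(k < nsteps e) coef e k w * (b (knot e k.+1) w - b (knot e k) w).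

(* I is the Ito integral of H over [0, t] against the Brownian motion b: the
   L^2 limit of the integrals of elementary processes that converge to H in
   L^2(Omega x [0, t]). *)
Definition is_ito_integral (b : R -> Omega -> R) (t : R) (H : R -> Omega -> R)
    (I : Omega -> R) : Prop :=
  measurable_fun [set: Omega] (I : Omega -> measurableTypeR R) /\
  exists e : nat -> elementary,
    [/\ forall k, is_elementary t (e k),
        (fun k => \int[P]_w \int[lebesgue_measure]_(s in `[0%R, t])
          ((elementary_val (e k) s w - H s w) ^+ 2)%:E)%E @ \oo --> 0%E &
        (fun k => \int[P]_w
          ((elementary_int b (e k) w - I w) ^+ 2)%:E)%E @ \oo --> 0%E].

Section Scheme.
Context (n : nat) (M : mesh R n).
Variables (p : nat) (eta N : R) (hF : facet M -> R).
Variables (nG : nat) (f : 'I_nG -> bvect M).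

(* open subsets of the finite-dimensional space V_p, for the L^2 norm *)
Definition openV (U : set (bscal M)) : Prop :=
  forall u, Vscal p u -> U u -> exists2 r : R, 0 < r &
    forall v, Vscal p v -> snorm (v - u) < r -> U v.

Definition continuous_path (u : R -> bscal M) : Prop :=
  forall t, 0 <= t <= T -> forall e : R, 0 < e -> exists2 r : R, 0 < r &
    forall s, 0 <= s <= T -> `|s - t| < r -> snorm (u s - u t) < e.

(* For each test function v and each time t, the weak equation holds almost
   surely, the exceptional set being allowed to depend on v and t. *)
Definition is_weak_solution (B : 'I_nG -> R -> Omega -> R) (rho0 : bscal M)
    (rho : R -> Omega -> bscal M) : Prop :=
  [/\ is_filtration /\ is_brownian B,
      forall t w, 0 <= t <= T -> Vscal p (rho t w),
      {ae P, forall w, continuous_path (rho ^~ w)} /\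
      (forall t U, 0 <= t <= T -> openV U -> Filt t (rho t @^-1` U)),
      forall v, Vscal p v -> forall t, 0 <= t <= T ->
        exists I : 'I_nG -> Omega -> R,
          (forall j, is_ito_integral (B j) t
             (fun s w => vinner (noise_field f (rho s w) j) (dgrad p v)) (I j)) /\
          {ae P, forall w, sinner (rho t w) v =
             sinner rho0 v
             - \int[lebesgue_measure]_(s in `[0, t]) sip_form eta hF (rho s w) v
             + (Num.sqrt N)^-1 * \sum_j I j w} &
      forall q : R, 2 <= q ->
        (\int[P]_w ereal_sup [set (snorm (rho t w) `^ q)%:E | t in `[0%R, T]]
           < +oo)%E].

End Scheme.
End Stochastic.

(* Main.v *)
Require Import Defs.
From HB Require Import structures.
From mathcomp Require Import all_boot all_order all_algebra.
From mathcomp Require Import -(notations) mpoly.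
From mathcomp Require Import all_classical all_reals all_analysis.
From mathcomp Require Import measurable_realfun.
From mathcomp Require Import ring lra.

Set Implicit Arguments.
Unset Strict Implicit.
Unset Printing Implicit Defensive.

Import Order.TTheory GRing.Theory Num.Theory.
Import numFieldNormedType.Exports.

Local Open Scope classical_set_scope.
Local Open Scope ring_scope.

(** Mass is the pairing of the solution with the constant function 1, which
    belongs to V_p and is a legitimate test function.  Both right-hand sides of
    the weak equation vanish on it because 1 has no gradient and no jump.

    The absence of a jump is a geometric fact: the jump of 1 across a facet is
    the sum of the two outward normals, and it is zero only if the two elements
    lie on opposite sides of the facet ([normals_cancel]).  If they lay on the
    same side, they would share a point that is interior to one of them; in a
    conforming mesh they are then the same element, so that both sides of the
    facet are the same face, whereas every face is one side of one facet.

    Hence the penalty form vanishes ([sip_form_one]), and the discrete gradient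
    of 1 is minus a sum of liftings of the zero function.  A lifting of zero is
    orthogonal to V_(p-1), which contains the noise fields, so every integrand
    of the noise term is zero ([dgrad_one_orthogonal]).  Splitting the inner
    product over the facets needs the integrability of polynomials on simplices
    ([integrable_peval]).

    A stochastic integral is only given as an L^2 limit of integrals of
    elementary processes, so that the integral of the zero process vanishes
    ([ito_integral0]) rests on an estimate of the second moment of an elementary
    integral by the squared L^2 norm of the integrand ([ito_inequality]).  It follows
    from the independence and the symmetry of the increments: flipping the sign
    of the last increment does not change the second moment, so the cross term
    disappears, without any integrability being needed beforehand.

    This gives the conservation of mass at each fixed time, almost surely.  It
    holds simultaneously at all rational times, and at all times by continuity
    of the paths, as the integral over the torus is continuous for the L^2 norm
    ([mass_conserved_path]). *)

(** * Simplices and barycentric coordinates *)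

Section Dot.
Context (R : realType) (n : nat).
Implicit Types x y z : 'rV[R]_n.

Lemma dotE x y : dot x y = (x *m y^T) 0 0.
Proof. by rewrite /dot mxE; apply: eq_bigr => i _; rewrite mxE. Qed.

Lemma dotBl x y z : dot (x - y) z = dot x z - dot y z.
Proof. by rewrite !dotE mulmxBl !mxE. Qed.

Lemma dotZr k x y : dot x (k *: y) = k * dot x y.
Proof. by rewrite !dotE linearZ /= -scalemxAr mxE. Qed.

Lemma dotr0 x : dot x 0 = 0.
Proof. by rewrite dotE trmx0 mulmx0 mxE. Qed.

Lemma dot_suml (I : finType) (w : I -> R) (a : I -> 'rV[R]_n) z :
  dot (\sum_i w i *: a i) z = \sum_i w i * dot (a i) z.
Proof.
rewrite dotE mulmx_suml summxE; apply: eq_bigr => i _.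
by rewrite dotE -scalemxAl mxE.
Qed.

Lemma enormZ k x : enorm (k *: x) = `|k| * enorm x.
Proof.
rewrite /enorm dotZr (_ : dot (k *: x) x = k * dot x x); last first.
  by rewrite !dotE -scalemxAl mxE.
by rewrite mulrA -expr2 sqrtrM ?sqr_ge0// sqrtr_sqr.
Qed.

End Dot.

Section Hull.
Context (R : realType) (n m : nat) (b : 'I_m -> 'rV[R]_n).

Lemma hull_vertex i : hull b setT (b i).
Proof.
exists (fun k => (k == i)%:R); split=> //.
- by move=> k /(_ Logic.I).
- by rewrite (bigD1 i)//= eqxx big1 ?addr0// => k /negbTE->.
- by rewrite (bigD1 i)//= eqxx scale1r big1 ?addr0// => k /negbTE->; rewrite scale0r.
Qed.

Lemma hull_convex (I : finType) (u : I -> R) (y : I -> 'rV[R]_n) :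
  (forall k, 0 <= u k) -> \sum_k u k = 1 -> (forall k, hull b setT (y k)) ->
  hull b setT (\sum_k u k *: y k).
Proof.
move=> u0 u1 /choice[w hw]; exists (fun i => \sum_k u k * w k i); split=> //.
- by move=> i; apply: sumr_ge0 => k _; rewrite mulr_ge0//; have [] := hw k.
- by move=> i /(_ Logic.I).
- rewrite exchange_big/= -[RHS]u1; apply: eq_bigr => k _.
  by rewrite -mulr_sumr; have [_ _ -> _] := hw k; rewrite mulr1.
- under [RHS]eq_bigr do rewrite scaler_suml.
  rewrite exchange_big/=; apply: eq_bigr => k _.
  have [_ _ _ {1}->] := hw k; rewrite scaler_sumr.
  by apply: eq_bigr => i _; rewrite scalerA.
Qed.

End Hull.

Section Simplex.
Context (R : realType) (n : nat) (a : 'I_n.+2 -> 'rV[R]_n.+1).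
Hypothesis a_free : row_free (edges a).

(** Rewrites affine combinations of vertices as linear combinations of edges,
    where linear algebra applies. *)
Lemma edges_comb (w : 'I_n.+2 -> R) :
  (\row_j w (lift ord0 j)) *m edges a =
  \sum_i w i *: a i - (\sum_i w i) *: a ord0.
Proof.
rewrite mulmx_sum_row scaler_suml -sumrB [RHS]big_ord_recl/= subrr add0r.
by apply: eq_bigr => j _; rewrite mxE rowK scalerBr.
Qed.

Lemma affine_indep (w : 'I_n.+2 -> R) :
  \sum_i w i = 0 -> \sum_i w i *: a i = 0 -> forall i, w i = 0.
Proof.
move=> w0 wa0.
have := edges_comb w; rewrite w0 wa0 scale0r subr0 => /eqP.
rewrite mulmx_free_eq0// => /eqP/rowP h.
have wl j : w (lift ord0 j) = 0 by have := h j; rewrite !mxE.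
move=> i; case: (unliftP ord0 i) => [j ->//|->].
by move: w0; rewrite big_ord_recl big1 ?addr0.
Qed.

Lemma affine_coord_uniq (w w' : 'I_n.+2 -> R) :
  \sum_i w i = \sum_i w' i -> \sum_i w i *: a i = \sum_i w' i *: a i -> w =1 w'.
Proof.
move=> e1 e2 i; apply/eqP; rewrite -subr_eq0; apply/eqP.
apply: (@affine_indep (fun i => w i - w' i)); first by rewrite sumrB e1 subrr.
by under eq_bigr do rewrite scalerBl; rewrite sumrB e2 subrr.
Qed.

Lemma vertex_inj : injective a.
Proof.
move=> i k e; apply/eqP; apply/negP => /negP ik.
have S l : \sum_j (j == l :> 'I_n.+2)%:R = 1 :> R.
  by rewrite (bigD1 l)//= eqxx big1 ?addr0// => j /negbTE->.
have Sa l : \sum_(j : 'I_n.+2) (j == l)%:R *: a j = a l.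
  by rewrite (bigD1 l)//= eqxx scale1r big1 ?addr0// => j /negbTE->; rewrite scale0r.
have := @affine_coord_uniq (fun l => (l == i)%:R) (fun l => (l == k)%:R).
rewrite !S !Sa e => /(_ erefl erefl i); rewrite eqxx (negbTE ik) => /eqP.
by rewrite oner_eq0.
Qed.

Definition bary_coord (x : 'rV[R]_n.+1) (i : 'I_n.+2) : R :=
  let v := (x - a ord0) *m invmx (edges a) in
  if unlift ord0 i is Some j then v 0 j else 1 - \sum_j v 0 j.

Lemma sum_bary_coord x : \sum_i bary_coord x i = 1.
Proof.
rewrite big_ord_recl /bary_coord unlift_none.
by under [X in _ + X = _]eq_bigr do rewrite liftK; rewrite subrK.
Qed.

Lemma bary_coordK x : \sum_i bary_coord x i *: a i = x.
Proof.
have := edges_comb (bary_coord x); rewrite sum_bary_coord scale1r => e.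
apply: (addIr (- a ord0)); rewrite -e.
rewrite (_ : \row_j _ = (x - a ord0) *m invmx (edges a)).
  by rewrite mulmxKV// -row_free_unit.
by apply/rowP => j; rewrite !mxE /bary_coord liftK mxE.
Qed.

Lemma bary_coord_unique (w : 'I_n.+2 -> R) x :
  \sum_i w i = 1 -> x = \sum_i w i *: a i -> bary_coord x =1 w.
Proof.
move=> w1 xE; apply: affine_coord_uniq; first by rewrite sum_bary_coord w1.
by rewrite bary_coordK.
Qed.

Lemma hull_bary_coordE x : hull a setT x <-> forall i, 0 <= bary_coord x i.
Proof.
split=> [[w [w0 _ w1 xw]] i|h]; first by rewrite (bary_coord_unique w1 xw).
exists (bary_coord x); split=> //; last by rewrite bary_coordK.
  by move=> i /(_ Logic.I).
exact: sum_bary_coord.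
Qed.

Definition outward_dir (i : 'I_n.+2) : 'rV[R]_n.+1 :=
  (invmx (\matrix_(j < n.+1) (a (lift i j) - a i)) *m const_mx 1)^T.

Lemma outward_normalE i :
  outward_normal a i = (enorm (outward_dir i))^-1 *: outward_dir i.
Proof. by []. Qed.

Lemma facet_edges_unit (i : 'I_n.+2) : \matrix_(j < n.+1) (a (lift i j) - a i) \in unitmx.
Proof.
rewrite -row_free_unit -kermx_eq0; apply/rowV0P => v /sub_kermxP.
rewrite mulmx_sum_row => v0.
pose w l := if unlift i l is Some j then v 0 j else - \sum_j v 0 j.
have wi : w i = - \sum_j v 0 j by rewrite /w unlift_none.
have wl j : w (lift i j) = v 0 j by rewrite /w liftK.
have w0 : forall l, w l = 0.
  apply: affine_indep.
    rewrite (bigD1_ord i)//= wi; under eq_bigr do rewrite wl.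
    by rewrite addNr.
  rewrite (bigD1_ord i)//= wi.
  have e : \sum_j v 0 j *: (a (lift i j) - a i) = 0.
    by rewrite -[RHS]v0; apply: eq_bigr => j _; rewrite rowK.
  rewrite scaleNr addrC scaler_suml -sumrB -[RHS]e.
  by apply: eq_bigr => j _; rewrite wl scalerBr.
by apply/rowP => j; rewrite -wl w0 mxE.
Qed.

(** The direction is determined by its values on the edges at [a i], because
    these edges form a basis. *)
Lemma outward_dirP (i : 'I_n.+2) (c : 'rV[R]_n.+1) (k : R) :
  (forall j, j != i -> dot (a j - a i) c = k) -> c = k *: outward_dir i.
Proof.
move=> h; apply: trmx_inj.
set A := \matrix_(j < n.+1) (a (lift i j) - a i).
have E : A *m c^T = k *: const_mx 1.
  apply/colP => j; rewrite mxE [RHS]mxE [in RHS]mxE mulr1 -(h (lift i j)); last first.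
    by rewrite eq_sym neq_lift.
  by rewrite dotE !mxE; apply: eq_bigr => l _; rewrite !mxE.
by rewrite linearZ/= trmxK scalemxAr -E mulKmx ?facet_edges_unit.
Qed.

Lemma dot_outward_dir i j : j != i -> dot (a j - a i) (outward_dir i) = 1.
Proof.
case: (unliftP i j) => [l ->|->]; last by rewrite eqxx.
move=> _; set A := \matrix_(j < n.+1) (a (lift i j) - a i).
have -> : a (lift i l) - a i = row l A by rewrite rowK.
by rewrite dotE trmxK -row_mul mulKVmx ?facet_edges_unit// !mxE.
Qed.

End Simplex.

(** * Normals on the two sides of a facet *)

Lemma outward_normal_translate (R : realType) (n : nat)
  (a : 'I_n.+2 -> 'rV[R]_n.+1) (z : 'rV[R]_n.+1) (i : 'I_n.+2) :
  outward_normal (fun j => a j + z) i = outward_normal a i.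
Proof.
rewrite !outward_normalE.
have -> // : outward_dir (fun j => a j + z) i = outward_dir a i.
rewrite /outward_dir; congr ((invmx _ *m _)^T).
by apply/matrixP => j k; rewrite !mxE opprD addrACA subrr addr0.
Qed.

Lemma edges_translate (R : realType) (n k : nat)
  (a : 'I_k.+1 -> 'rV[R]_n) (z : 'rV[R]_n) : edges (fun j => a j + z) = edges a.
Proof. by apply/row_matrixP => j; rewrite !rowK opprD addrACA subrr addr0. Qed.

Lemma hull_translate (R : realType) (n m : nat) (a : 'I_m -> 'rV[R]_n)
  (z x : 'rV[R]_n) : hull (fun j => a j + z) setT x -> hull a setT (x - z).
Proof.
move=> [w [w0 _ w1 ->]]; exists w; split => //; first by move=> i /(_ Logic.I).
under eq_bigr do rewrite scalerDr.
by rewrite big_split/= -scaler_suml w1 scale1r addrK.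
Qed.

(** Two simplices of which one face of the first, opposite to [a i], is a face of
    the second, opposite to [b i'].  The sign of the coordinate of [b i'] with
    respect to [a i] tells on which side of the common face the second one lies. *)
Section CommonFace.
Context (R : realType) (n : nat) (a b : 'I_n.+2 -> 'rV[R]_n.+1) (i i' : 'I_n.+2).
Hypotheses (a_free : row_free (edges a)) (b_free : row_free (edges b)).
Hypothesis face_sub : forall j, j != i -> exists2 j', j' != i' & a j = b j'.

(** Both directions are orthogonal to the face, hence proportional; evaluating
    them on the segment from [b i'] to the face gives the factor, which is the
    inverse of the coordinate. *)
Lemma outward_normals_opposite :
  bary_coord a (b i') i < 0 -> outward_normal a i + outward_normal b i' = 0.
Proof.
set mu := bary_coord a (b i') => mu0.
set c := outward_dir a i; set c' := outward_dir b i'.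
have c'1 j : j != i -> dot (a j) c' = 1 + dot (b i') c'.
  move=> /face_sub[j' ji' ->]; apply/eqP; rewrite -subr_eq -dotBl.
  by rewrite dot_outward_dir.
have c'E j : j != i -> dot (a j - a i) c' = 1 + dot (b i') c' - dot (a i) c'.
  by move=> ji; rewrite dotBl c'1.
set k := 1 + _ - _ in c'E.
have c'k : c' = k *: c by exact: outward_dirP.
have kmu : k * mu i = 1.
  have aj j : j != i -> dot (a j) c = dot (a i) c + 1.
    by move=> ji; apply/eqP; rewrite addrC -subr_eq -dotBl dot_outward_dir.
  have bi : dot (b i') c = dot (a i) c + 1 - mu i.
    have := sum_bary_coord a (b i'); rewrite (bigD1 i)//= -/mu => /eqP.
    rewrite addrC eq_sym -subr_eq => /eqP mu1.
    rewrite -[b i'](bary_coordK a_free) dot_suml (bigD1 i)//= -/mu.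
    rewrite (eq_bigr (fun j => mu j * (dot (a i) c + 1))); last first.
      by move=> j ji; rewrite aj.
    by rewrite -mulr_suml -mu1; ring.
  have ji : lift i (ord0 : 'I_n.+1) != i by rewrite eq_sym neq_lift.
  have : dot (a (lift i ord0) - b i') c' = 1 by rewrite dotBl c'1// addrK.
  by rewrite c'k dotZr dotBl bi aj// => <-; ring.
have k0 : k < 0.
  rewrite ltNge; apply/negP => k0.
  by have := mulr_ge0_le0 k0 (ltW mu0); rewrite kmu ler10.
rewrite !outward_normalE -/c -/c' c'k enormZ ltr0_norm// invfM scalerA.
by rewrite mulrAC invrN mulNr mulVf ?lt_eqF// mulN1r scaleNr subrr.
Qed.

(** Otherwise [b i'] would lie in the hyperplane of its own opposite face. *)
Lemma bary_coord_opposite_neq0 : bary_coord a (b i') i != 0.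
Proof.
apply/eqP => mu0.
pose c := outward_dir b i'.
have aj j : j != i -> dot (a j) c = dot (b i') c + 1.
  by move=> /face_sub[j' ji' ->]; apply/eqP; rewrite addrC -subr_eq -dotBl dot_outward_dir.
have := sum_bary_coord a (b i'); rewrite (bigD1 i)//= mu0 add0r => s1.
have : dot (b i') c = dot (b i') c + 1.
  rewrite -[in LHS](bary_coordK a_free (b i')) dot_suml (bigD1 i)//= mu0 mul0r add0r.
  rewrite -[RHS]mul1r -{1}s1 mulr_suml.
  apply: eq_bigr => j ji.
  by rewrite aj.
by move/eqP; rewrite addrC -subr_eq subrr eq_sym oner_eq0.
Qed.

(** Moving from the barycentre of the face slightly towards [b i'] stays in the
    second simplex and makes all coordinates in the first one positive. *)
Lemma overlap_interior_point : 0 < bary_coord a (b i') i ->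
  exists2 x, hull b setT x & forall j, 0 < bary_coord a x j.
Proof.
set mu := bary_coord a (b i') => mu0.
(* [eps] is the weight of [b i'], chosen so small that its contribution, at least
   [- eps * C] in each coordinate, is dominated by the barycentre. *)
pose C := \sum_j `|mu j|.
have C0 : 0 <= C by apply: sumr_ge0 => j _; rewrite normr_ge0.
have muC j : - C <= mu j.
  rewrite lerNl (le_trans (ler_norm _))// normrN /C (bigD1 j)//= lerDl.
  by apply: sumr_ge0 => k _; rewrite normr_ge0.
pose N : R := n.+1%:R.
have N0 : 0 < N by rewrite ltr0n.
pose D := 2 + N * C.
have D0 : 0 < D by rewrite /D; nra.
pose eps := D^-1.
have eps0 : 0 < eps by rewrite invr_gt0.
have epsD : eps * 2 + eps * (N * C) = 1 by rewrite -mulrDr mulVf// gt_eqF.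
have epsC : 0 <= eps * (N * C) by rewrite !mulr_ge0// ltW.
pose u (j : 'I_n.+2) := if j == i then eps else (1 - eps) / N.
pose y (j : 'I_n.+2) := if j == i then b i' else a j.
have u0 j : 0 <= u j.
  rewrite /u; case: ifP => _; first exact: ltW.
  by rewrite divr_ge0 ?(ltW N0)//; lra.
have cardi : \sum_(j : 'I_n.+2 | j != i) (1 : R) = N.
  by rewrite sumr_const cardC1 card_ord.
have u1 : \sum_j u j = 1.
  rewrite (bigD1 i)//= {1}/u eqxx (eq_bigr (fun=> (1 - eps) / N * 1)); last first.
    by move=> j /negbTE ji; rewrite /u ji mulr1.
  by rewrite -mulr_sumr cardi divfK ?gt_eqF// addrC subrK.
exists (\sum_j u j *: y j).
  apply: hull_convex => // j; rewrite /y; case: eqP => [_|/eqP ji].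
    exact: hull_vertex.
  by have [j' _ ->] := face_sub ji; exact: hull_vertex.
pose w j := (if j == i then 0 else u j) + eps * mu j.
have w1 : \sum_j w j = 1.
  rewrite big_split/= -mulr_sumr sum_bary_coord mulr1 -u1 [RHS](bigD1 i)//= addrC.
  rewrite {2}/u eqxx; congr (_ + _); rewrite (bigD1 i)//= eqxx add0r.
  by apply: eq_bigr => j /negbTE->.
have wx : \sum_j u j *: y j = \sum_j w j *: a j.
  under [RHS]eq_bigr do rewrite scalerDl -scalerA.
  rewrite big_split/= -scaler_sumr bary_coordK// (bigD1 i)//= /u /y eqxx addrC.
  congr (_ + _); rewrite [RHS](bigD1 i)//= eqxx scale0r add0r.
  by apply: eq_bigr => j /negbTE->.
move=> j; rewrite (bary_coord_unique a_free w1 wx) /w; case: ifP => [/eqP->|ji].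
  by rewrite add0r mulr_gt0.
rewrite /u ji.
have : 0 < (1 - eps - eps * (N * C)) / N.
  by rewrite divr_gt0//; lra.
have -> : (1 - eps - eps * (N * C)) / N = (1 - eps) / N - eps * C.
  by field; rewrite gt_eqF.
move=> h; apply: lt_le_trans h _; rewrite lerD2l -mulrN.
by rewrite ler_wpM2l// ltW.
Qed.

End CommonFace.

Section Facet.
Context (R : realType) (n : nat) (M : mesh R n).
Hypothesis hM : is_mesh M.

(** If the two elements were on the same side, the conformity of the mesh would
    identify them at a point interior to the first one, and the facet would have
    the same face on both of its sides, whereas the sides are listed once. *)
Lemma normals_cancel (F : facet M) : normal F false + normal F true = 0.
Proof.
have [_ afree _ [conf uniq] [sbij match_]] := hM.
rewrite /normal; move: (match_ F); rewrite /face_vertices.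
case E0 : (side F false) => [K i]; case E1 : (side F true) => [K' i'] /= fE.
pose a := vtx K; pose b j := vtx K' j + Defs.shift F.
have bfree : row_free (edges b) by rewrite edges_translate; exact: afree.
have face_sub j : j != i -> exists2 j', j' != i' & a j = b j'.
  move=> ji; have : [set vtx K j | j in [set j | j != i]] (a j) by exists j.
  by rewrite fE => -[_ [j' /= ji' <-] <-]; exists j'.
rewrite -(outward_normal_translate (vtx K') (Defs.shift F) i').
have [mu0|mu0|mu0] := ltgtP (bary_coord a (b i') i) 0.
- exact: (@outward_normals_opposite R n a b i i' (afree K) bfree face_sub).
- exfalso.
  have [x xb xa] := overlap_interior_point (afree K) face_sub mu0.
  have xK : simplex K x by apply/(hull_bary_coordE (afree K)) => j; exact: ltW.
  have [w [_ wJ w1 wx]] := conf _ _ (zshift F) _ xK (hull_translate xb).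
  (* all the weights of the interior point are positive, so no vertex is missing *)
  have shared k : exists j, a k = b j.
    apply: contrapT => nk; have := xa k.
    by rewrite (bary_coord_unique (afree K) w1 wx) wJ ?ltxx.
  have [f fP] := choice shared.
  have finj : injective f.
    by move=> k l fkl; apply: (vertex_inj (afree K)); rewrite -/a !fP fkl.
  have [g _ gK] := injF_bij finj.
  have rE : range a = [set vtx K' j + Defs.shift F | j in [set: 'I_n.+2]].
    apply/seteqP; split => [_ [k _ <-]|_ [j _ <-]].
      by exists (f k) => //; rewrite fP.
    by exists (g j) => //; rewrite fP gK.
  have [KK z0] := uniq K K' (zshift F) rE.
  have s0 : Defs.shift F = 0 by rewrite /Defs.shift /lattice z0 map_mx0 scaler0.
  have ba : b =1 a by move=> j; rewrite /b s0 addr0 -KK.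
  have ii : i = i'.
    apply/eqP; apply/negP => /negP ii.
    have [|j' ji' /esym] := face_sub i'; first by rewrite eq_sym.
    by rewrite ba => /(vertex_inj (afree K)) jj; rewrite jj eqxx in ji'.
  have := bij_inj sbij (_ : side (F, false).1 (F, false).2 = side (F, true).1 (F, true).2).
  by rewrite /= E0 E1 KK ii => /(_ erefl).
- by have := bary_coord_opposite_neq0 (afree K) bfree face_sub; rewrite mu0 eqxx.
Qed.

End Facet.

(** * Integration of polynomials over a simplex *)

Section LebesgueCube.
Context (R : realType).
Local Notation rT := (measurableTypeR R).

Definition cube n (C : R) : set (n.-tuple rT) :=
  [set x | forall i, `|tnth x i| <= C].

Lemma measurable_cube n C : measurable (@cube n C).
Proof.
rewrite (_ : cube C = \bigcap_(i in [set: 'I_n]) ((@tnth n rT ^~ i) @^-1` `[- C, C]%classic)).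
  apply: fin_bigcap_measurable; first exact: finite_finset.
  move=> i _; rewrite -[X in measurable X]setTI; apply: measurable_tnth => //.
apply/seteqP; split=> x h i.
  by move=> _ /=; rewrite in_itv/= -ler_norml; exact: h.
by have := h i Logic.I; rewrite /= in_itv/= -ler_norml.
Qed.

Lemma lebesgue_Rn_cube_lty n C : (lebesgue_Rn R n (@cube n C) < +oo)%E.
Proof.
elim: n => [|n IH].
  apply: (@le_lt_trans _ _ 1%E); last exact: ltry.
  exact: (@probability_le1 _ _ _ (\d_([tuple] : 0.-tuple rT))%E _ (measurable_cube C)).
have lC : (@lebesgue_measure R `[(- C)%R, C]%classic < +oo)%E.
  by rewrite lebesgue_measure_itv/=; case: ifP => // _; rewrite -EFinD ltry.
change (((@lebesgue_measure R \x lebesgue_Rn R n)%E (@tcons R n @^-1` @cube n.+1 C) < +oo)%E).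
rewrite (_ : _ @^-1` _ = `[- C, C]%classic `*` @cube n C).
  rewrite product_measure1E//; last exact: measurable_cube.
  by rewrite lte_mul_pinfty// ge0_fin_numE.
apply/seteqP; split => [[x y]|[x y] [/= xC yC]] /=.
  move=> h; split => /=.
    by have := h ord0; rewrite tnth0 in_itv/= -ler_norml.
  by move=> i; have := h (lift ord0 i); rewrite tnthS.
move=> i; case: (unliftP ord0 i) => [j ->|->]; first by rewrite tnthS; exact: yC.
by rewrite tnth0; move: xC; rewrite in_itv/= -ler_norml.
Qed.

End LebesgueCube.

Section PolyIntegral.
Context (R : realType) (n : nat) (a : 'I_n.+2 -> 'rV[R]_n.+1).
Hypothesis a_free : row_free (edges a).
Local Notation rT := (measurableTypeR R).
Local Notation d := n.+1.
Local Notation D := [set x : d.-tuple rT | hull a setT (rV_of_tuple x)].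

Lemma measurable_peval (q : mpoly d R) :
  measurable_fun [set: d.-tuple rT] (fun x => peval q (rV_of_tuple x) : rT).
Proof.
rewrite (_ : (fun x => _) = fun x : d.-tuple rT =>
    \sum_(m <- msupp q) mcoeff m q * \prod_i tnth x i ^+ m i).
  apply: measurable_sum => m; apply: measurable_funM => //.
  apply: measurable_prod => i _; apply: measurable_funX; exact: measurable_tnth.
apply/funext => x; rewrite /peval mevalE; apply: eq_bigr => m _.
by congr (_ * _); apply: eq_bigr => i _; rewrite mxE.
Qed.

Lemma measurable_simplex : measurable D.
Proof.
rewrite (_ : D = \bigcap_(i in [set: 'I_d.+1])
    ((fun x => bary_coord a (rV_of_tuple x) i) @^-1` `[0, +oo[%classic)); last first.
  apply/seteqP; split => x.
    by move=> /(hull_bary_coordE a_free) h i _ /=; rewrite in_itv/= h.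
  move=> h; apply/(hull_bary_coordE a_free) => i; have := h i Logic.I.
  by rewrite /= in_itv/= andbT.
apply: fin_bigcap_measurable; first exact: finite_finset.
move=> i _; rewrite -[X in measurable X]setTI.
have mv j : measurable_fun [set: d.-tuple rT]
    (fun x => ((rV_of_tuple x - a ord0) *m invmx (edges a)) 0 j : rT).
  under eq_fun do rewrite mxE.
  apply: measurable_sum => k; apply: measurable_funM => //.
  under eq_fun do rewrite !mxE.
  by apply: measurable_funB => //; exact: measurable_tnth.
have : measurable_fun [set: d.-tuple rT] (fun x => bary_coord a (rV_of_tuple x) i : rT).
  rewrite /bary_coord; case: (unlift ord0 i) => [j|]; first exact: mv.
  by apply: measurable_funB => //; exact: measurable_sum.
by apply => //.
Qed.

Lemma simplex_sub_cube : exists C, D `<=` cube C.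
Proof.
exists (\sum_i \sum_k `|a i 0 k|) => x [w [w0 _ w1 xw]] k.
have -> : tnth x k = (rV_of_tuple x) 0 k by rewrite mxE.
rewrite xw summxE (le_trans (ler_norm_sum _ _ _))//; apply: ler_sum => i _.
rewrite mxE normrM ger0_norm//.
have wle : w i <= 1.
  by rewrite -w1 (bigD1 i)//= lerDl sumr_ge0.
rewrite (@le_trans _ _ `|a i 0 k|)//; first by rewrite ler_piMl.
by rewrite (bigD1 k)//= lerDl sumr_ge0.
Qed.

Lemma integrable_peval (q : mpoly d R) :
  (lebesgue_Rn R d).-integrable D (EFin \o (fun x => peval q (rV_of_tuple x))).
Proof.
have [C DC] := simplex_sub_cube.
apply: measurable_bounded_integrable.
- exact: measurable_simplex.
- apply: le_lt_trans (lebesgue_Rn_cube_lty d C).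
  by apply: le_measure => //; rewrite inE; [exact: measurable_simplex|exact: measurable_cube].
- by apply: measurable_funTS; exact: measurable_peval.
exists (\sum_(m <- msupp q) `|mcoeff m q| * \prod_i C ^+ m i).
split; first exact: num_real.
move=> B ltB x /DC xC; apply: le_trans (ltW ltB).
rewrite /peval mevalE (le_trans (ler_norm_sum _ _ _))//.
apply: ler_sum => m _; rewrite normrM ler_wpM2l// normr_prod.
apply: ler_prod => i _; rewrite normr_ge0/= normrX lerXn2r ?nnegrE//.
  by apply: le_trans (xC i).
by rewrite mxE; exact: xC.
Qed.

Lemma vol_int_pevalD (q r : mpoly d R) :
  vol_int (hull a setT) (peval (q + r)) =
  vol_int (hull a setT) (peval q) + vol_int (hull a setT) (peval r).
Proof.
rewrite /vol_int -RintegralD; [|exact: measurable_simplex|exact: integrable_peval..].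
by apply: eq_Rintegral => x _; rewrite /peval mevalD.
Qed.

Lemma vol_int_pevalZ c (q : mpoly d R) :
  vol_int (hull a setT) (peval (c *: q)) = c * vol_int (hull a setT) (peval q).
Proof.
rewrite /vol_int -RintegralZl; [|exact: measurable_simplex|exact: integrable_peval].
by apply: eq_Rintegral => x _; rewrite /peval mevalZ.
Qed.

End PolyIntegral.

(** * The constant test function *)

Lemma vol_int0 (R : realType) (n : nat) (K : set 'rV[R]_n) :
  vol_int K (fun=> 0) = 0.
Proof. by rewrite /vol_int /Rintegral integral0. Qed.

Section MeshIntegral.
Context (R : realType) (n : nat) (M : mesh R n).
Hypothesis hM : is_mesh M.
Local Notation d := n.+1.
Implicit Types (q r : elt M -> mpoly d R) (u v : bscal M) (g h : bvect M).

Let elt_free (K : elt M) : row_free (edges (vtx K)).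
Proof. by have [_ + _ _ _] := hM; apply. Qed.

Definition poly_int q : R := torus_int (fun K => peval (q K)).

Lemma poly_intD q r : poly_int (fun K => q K + r K) = poly_int q + poly_int r.
Proof.
rewrite /poly_int /torus_int -big_split/=; apply: eq_bigr => K _.
exact: vol_int_pevalD.
Qed.

Lemma poly_intZ c q : poly_int (fun K => c *: q K) = c * poly_int q.
Proof.
rewrite /poly_int /torus_int mulr_sumr; apply: eq_bigr => K _.
exact: vol_int_pevalZ.
Qed.

Lemma eq_torus_int (f1 f2 : elt M -> 'rV[R]_d -> R) :
  (forall K x, f1 K x = f2 K x) -> torus_int f1 = torus_int f2.
Proof.
by move=> e; apply: eq_bigr => K _; apply: eq_Rintegral => x _; exact: e.
Qed.

Lemma torus_int_ge0 (f1 : elt M -> 'rV[R]_d -> R) :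
  (forall K x, 0 <= f1 K x) -> 0 <= torus_int f1.
Proof. by move=> e; apply: sumr_ge0 => K _; apply: Rintegral_ge0 => x _; exact: e. Qed.

Lemma torus_int_sevalE u : torus_int (seval u) = poly_int u.
Proof. by []. Qed.

Lemma torus_int_sevalB u v :
  torus_int (seval (u - v)) = torus_int (seval u) - torus_int (seval v).
Proof.
rewrite -[- torus_int _]mulN1r !torus_int_sevalE -poly_intZ -poly_intD.
by apply: eq_torus_int => K x; rewrite !ffunE scaleN1r.
Qed.

Lemma sinner_ge0 u : 0 <= sinner u u.
Proof. by apply: torus_int_ge0 => K x; rewrite -expr2 sqr_ge0. Qed.

(** Young's inequality, from the integral of [(u - k) ^+ 2]; it replaces the
    Cauchy-Schwarz inequality in the control of the integral by the L^2 norm. *)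
Lemma torus_int_young u (k : R) :
  2 * k * torus_int (seval u) <= sinner u u + k ^+ 2 * torus_int (fun (_ : elt M) _ => 1 : R).
Proof.
have -> : sinner u u = poly_int (fun K => u K * u K).
  by apply: eq_torus_int => K x; rewrite /peval mevalM.
have -> : torus_int (fun (_ : elt M) _ => 1 : R) = poly_int (fun=> 1).
  by apply: eq_torus_int => K x; rewrite /peval meval1.
rewrite torus_int_sevalE -!poly_intZ -subr_ge0 -mulN1r -poly_intZ -!poly_intD.
apply: torus_int_ge0 => K x.
rewrite /peval !(mevalD, mevalZ, mevalM, meval1).
set y := meval _ _; rewrite (_ : _ + _ = (y - k) ^+ 2) ?sqr_ge0//; ring.
Qed.

Lemma vinnerE g h : vinner g h = poly_int (fun K => \sum_i g K i * h K i).
Proof.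
apply: eq_torus_int => K x; rewrite /peval /dot raddf_sum/=.
by apply: eq_bigr => i _; rewrite !mxE mevalM.
Qed.

Lemma vinnerDr g h1 h2 : vinner g (h1 + h2) = vinner g h1 + vinner g h2.
Proof.
rewrite !vinnerE -poly_intD; congr poly_int; apply/funext => K.
by rewrite -big_split/=; apply: eq_bigr => i _; rewrite !ffunE mulrDr.
Qed.

Lemma vinner0r g : vinner g 0 = 0.
Proof. by apply: (addIr (vinner g 0)); rewrite -vinnerDr !add0r. Qed.

Lemma vinnerNr g h : vinner g (- h) = - vinner g h.
Proof. by apply: (addIr (vinner g h)); rewrite -vinnerDr !addNr vinner0r. Qed.

Lemma vinnerC g h : vinner g h = vinner h g.
Proof. by apply: eq_torus_int => K x; rewrite /dot; apply: eq_bigr => i _; rewrite mulrC. Qed.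

Lemma facet_int0 (F : facet M) : facet_int F (fun=> 0) = 0.
Proof. by rewrite /facet_int /surf_int vol_int0 mulr0. Qed.

Lemma Vvect0 l : Vvect l (0 : bvect M).
Proof. by move=> K i; rewrite !ffunE msize0. Qed.

Lemma VvectD l g h : Vvect l g -> Vvect l h -> Vvect l (g + h).
Proof.
move=> hg hh K i; rewrite !ffunE (leq_trans (msizeD_le _ _))//.
by rewrite geq_max hg hh.
Qed.

Lemma VvectZ l c g : Vvect l g -> Vvect l (c *: g).
Proof. by move=> hg K i; rewrite !ffunE (leq_trans (msizeZ_le _ _))// hg. Qed.

Lemma Vvect_noise_field l nG (f : 'I_nG -> bvect M) u j :
  is_basis l f -> Vvect l (noise_field f u j).
Proof.
move=> [hf _]; rewrite /noise_field; elim/big_ind: _ => //.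
- exact: Vvect0.
- exact: VvectD.
- by move=> i _; apply: VvectZ.
Qed.

(** A lifting is an arbitrary choice among its representatives; the zero field
    shows that there is one, and the defining identity alone gives the
    orthogonality, whichever is chosen. *)
Lemma lifting0_orthogonal l (F : facet M) g :
  Vvect l g -> vinner g (lifting l F (fun=> 0)) = 0.
Proof.
have [|_ h] := @xgetPex _ (0 : bvect M) [set L | is_lifting l F (fun=> 0) L].
  exists 0; split=> [|v _]; first exact: Vvect0.
  rewrite vinnerC vinner0r; under eq_fun do rewrite dotr0.
  by rewrite facet_int0.
move=> /h; rewrite vinnerC => ->; under eq_fun do rewrite dotr0.
by rewrite facet_int0.
Qed.

Definition const_one : bscal M := [ffun=> 1].

Lemma Vscal_const_one p : Vscal p const_one.
Proof. by move=> K; rewrite ffunE msize1. Qed.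

Lemma seval_one K x : seval const_one K x = 1.
Proof. by rewrite /seval ffunE /peval meval1. Qed.

Lemma sinner_one u : sinner u const_one = torus_int (seval u).
Proof. by apply: eq_torus_int => K x; rewrite seval_one mulr1. Qed.

Lemma grad_one : grad const_one = 0.
Proof. by apply/ffunP => K; apply/ffunP => i; rewrite !ffunE -mpolyC1 mderivC. Qed.

Lemma jump_one (F : facet M) : jump F const_one = fun=> 0.
Proof.
apply/funext => x; rewrite /jump /Defs.strace !seval_one !scale1r.
exact: normals_cancel.
Qed.

Lemma sip_form_one eta hF u : sip_form eta hF u const_one = 0.
Proof.
rewrite /sip_form grad_one vinner0r mulr0 sub0r.
rewrite !big1 ?mulr0 ?oppr0 ?addr0// => F _.
  rewrite jump_one; under eq_fun do rewrite dotr0.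
  by rewrite facet_int0 mulr0.
rewrite jump_one (_ : (fun x => _) = fun=> 0) ?facet_int0//.
apply/funext => x; rewrite dotr0 addr0.
have -> : avg F (0 : bvect M) x = 0; last by rewrite dotr0.
rewrite /avg /vtrace.
have v0 K y : veval (0 : bvect M) K y = 0.
  by apply/rowP => i; rewrite !mxE !ffunE /peval meval0.
by rewrite !v0 addr0 scaler0.
Qed.

Lemma dgrad_one_orthogonal p g : Vvect p.-1 g -> vinner g (dgrad p const_one) = 0.
Proof.
move=> hg; rewrite /dgrad grad_one sub0r vinnerNr; apply/eqP; rewrite oppr_eq0.
apply/eqP; elim/big_ind: _ => [|x y x0 y0|F _]; first exact: vinner0r.
  by rewrite vinnerDr x0 y0 addr0.
by rewrite jump_one; exact: lifting0_orthogonal.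
Qed.

End MeshIntegral.

(** * Gaussian increments *)

Section Normal.
Context (R : realType) (s : R) (s0 : s != 0).
Local Notation mu := (@lebesgue_measure R).
Local Open Scope ereal_scope.

(** The density is a Radon-Nikodym derivative, almost everywhere equal to the one
    for which the change of variables is known. *)
Lemma ge0_integral_normal_prob (f : measurableTypeR R -> \bar R) :
  measurable_fun [set: measurableTypeR R] f -> (forall x, 0 <= f x) ->
  \int[normal_prob 0 s]_x f x = \int[mu]_x (f x * (normal_pdf 0 s x)%:E).
Proof.
move=> mf f0.
have dom := normal_prob_dominates (0 : R) s.
rewrite -(Radon_Nikodym_SigmaFinite.change_of_variables dom f0 measurableT mf).
have mpdf : measurable_fun [set: measurableTypeR R] (fun x => (normal_pdf 0 s x)%:E).
  by apply/measurable_EFinP; exact: measurable_normal_pdf.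
have iRN := Radon_Nikodym_SigmaFinite.f_integrable dom.
apply: ae_eq_integral => //.
- by apply: emeasurable_funM => //; exact: measurable_int iRN.
- exact: emeasurable_funM.
- apply: ae_eqe_mul2l; apply: integral_ae_eq => //.
  move=> E _ mE.
  by rewrite -Radon_Nikodym_SigmaFinite.f_integral.
Qed.

Lemma normal_pdf_opp (x : R) : normal_pdf 0 s (- x) = normal_pdf 0 s x.
Proof. by rewrite !normal_pdfE// /normal_fun !subr0 sqrrN. Qed.

Lemma normal_prob_opp (A : set (measurableTypeR R)) : measurable A ->
  normal_prob 0 s (-%R @^-1` A) = normal_prob 0 s A.
Proof.
move=> mA; rewrite /normal_prob.
have mopp : measurable_fun [set: measurableTypeR R] (-%R : R -> measurableTypeR R).
  exact: oppr_measurable.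
rewrite [RHS](_ : _ = \int[pushforward mu (-%R : R -> measurableTypeR R)]_(x in A)
    (normal_pdf 0 s x)%:E); last first.
  by apply: eq_measure_integral => B mB _; exact/esym/lebesgue_measureN.
rewrite (ge0_integral_pushforward mopp _ mA).
- by apply: eq_integral => x _; rewrite /comp normal_pdf_opp.
- by apply/measurable_EFinP/measurable_funTS; exact: measurable_normal_pdf.
- by move=> x _; rewrite lee_fin normal_pdf_ge0.
Qed.

(** The second moment is compared with the mass of a wider Gaussian: with
    [u = x^2 / (4 s^2)], the density of variance [s^2] decays like [exp (- 2 u)]
    and that of variance [2 s^2] like [exp (- u)], so the factor [u] is absorbed
    by [u exp (- u) <= 1].  The constant is not the sharp one, but any multiple of
    the variance is enough. *)
Lemma normal_prob_sqr_le :
  \int[normal_prob 0 s]_x (x ^+ 2)%:E <= (8 * s ^+ 2)%:E.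
Proof.
rewrite ge0_integral_normal_prob//; last 2 first.
- by apply/measurable_EFinP; exact: measurable_funX.
- by move=> x; rewrite lee_fin sqr_ge0.
have r2 : (Num.sqrt 2 ^+ 2 = 2 :> R)%R by rewrite sqr_sqrtr.
have t0 : (s * Num.sqrt 2)%R != 0%R.
  by rewrite mulf_neq0// gt_eqF// sqrtr_gt0.
apply: (@le_trans _ _ (\int[mu]_x ((8 * s ^+ 2)%:E *
    (normal_pdf 0 (s * Num.sqrt 2) x)%:E))); last first.
  rewrite ge0_integralZl//=.
  - by rewrite integral_normal_pdf mule1.
  - by apply/measurable_EFinP; exact: measurable_normal_pdf.
  - by move=> x _; rewrite lee_fin normal_pdf_ge0.
  - by rewrite lee_fin mulr_ge0// sqr_ge0.
apply: ge0_le_integral => //=.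
- by move=> x _; rewrite -EFinM lee_fin mulr_ge0// ?sqr_ge0// normal_pdf_ge0.
- apply: emeasurable_funM; apply/measurable_EFinP; first exact: measurable_funX.
  exact: measurable_normal_pdf.
- apply: emeasurable_funM; apply/measurable_EFinP => //.
  exact: measurable_normal_pdf.
- move=> x _; rewrite -!EFinM lee_fin !normal_pdfE// /normal_fun !subr0.
  rewrite exprMn r2.
  have s2 : (0 < s ^+ 2)%R by rewrite exprn_even_gt0.
  set u := (x ^+ 2 / (4 * s ^+ 2))%R.
  have -> : (- x ^+ 2 / (s ^+ 2 *+ 2) = - u - u)%R.
    by rewrite /u; field.
  have -> : (- x ^+ 2 / (s ^+ 2 * 2 *+ 2) = - u)%R by rewrite /u; field.
  have -> : (x ^+ 2 = 4 * s ^+ 2 * u)%R by rewrite /u; field.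
  have u0 : (0 <= u)%R by rewrite /u divr_ge0// ?sqr_ge0// mulr_ge0// ltW.
  have hp : (normal_peak s <= 2 * normal_peak (s * Num.sqrt 2))%R.
    rewrite /normal_peak exprMn r2.
    have pp := pi_gt0 R.
    have -> : (s ^+ 2 * 2 * pi *+ 2 = (s ^+ 2 * pi *+ 2) * 2)%R by ring.
    have q0 : (0 < s ^+ 2 * pi *+ 2)%R by rewrite pmulrn_rgt0// mulr_gt0.
    rewrite (sqrtrM _ (ltW q0)) invfM mulrCA -[leLHS]mulr1.
    apply: ler_wpM2l; first by rewrite invr_ge0 sqrtr_ge0.
    have q2 : (0 < Num.sqrt 2 :> R)%R by rewrite sqrtr_gt0.
    rewrite ler_pdivlMr// mul1r.
    by move: r2; rewrite expr2 => r2; nra.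
  have hu : (u * expR (- u) <= 1)%R.
    rewrite expRN ler_pdivrMr ?expR_gt0// mul1r.
    by apply: le_trans (expR_ge1Dx u); rewrite lerDr.
  rewrite expRD.
  have e0 := expR_gt0 (- u).
  have p0 := normal_peak_ge0 s.
  have p1 := normal_peak_ge0 (s * Num.sqrt 2).
  rewrite [leLHS](_ : _ = (4 * s ^+ 2) *
      ((u * expR (- u)) * (normal_peak s * expR (- u))))%R; last by ring.
  rewrite [leRHS](_ : _ = (4 * s ^+ 2) *
      (1 * (2 * normal_peak (s * Num.sqrt 2) * expR (- u))))%R; last by ring.
  apply: ler_wpM2l; first by rewrite mulr_ge0// ltW.
  apply: ler_pM => //; first by rewrite mulr_ge0// ltW.
    by rewrite mulr_ge0// ltW.
  by rewrite ler_wpM2r// ltW.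
Qed.

End Normal.

Section Independence.
Local Open Scope ereal_scope.
Context (R : realType) (d dO : measure_display) (T : measurableType d)
  (Omega : measurableType dO) (P : probability Omega R)
  (nu : probability (measurableTypeR R) R).
Variables (X : {mfun Omega >-> T}) (Y : {mfun Omega >-> measurableTypeR R}).
Hypothesis XY : forall A C, measurable A -> measurable C ->
  P (X @^-1` A `&` Y @^-1` C) = P (X @^-1` A) * nu C.

(** By uniqueness of the product measure, independence makes the joint law a
    product, and Tonelli's theorem applies. *)
Lemma ge0_integral_independent (f : T * measurableTypeR R -> \bar R) :
  measurable_fun setT f -> (forall z, 0 <= f z) ->
  \int[P]_w f (X w, Y w) = \int[distribution P X]_x \int[nu]_y f (x, y).
Proof.
move=> mf f0.
have mZ : measurable_fun setT (fun w => (X w, Y w)).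
  by apply: measurable_fun_pair; exact: measurable_funPT.
pose Z : {mfun Omega >-> (T * measurableTypeR R)%type} :=
  HB.pack (fun w => (X w, Y w)) (isMeasurableFun.Build _ _ _ _ _ mZ).
rewrite -(@fubini_tonelli1 _ _ _ _ _ (distribution P X) nu f)//.
rewrite [RHS](_ : _ = \int[distribution P Z]_z f z); last first.
  apply: eq_measure_integral => A mA _.
  apply: (@product_measure_unique _ _ _ _ _ (distribution P X) nu
    (distribution P Z)) => //.
by rewrite ge0_integral_distribution.
Qed.

Hypothesis nu_sym : forall A : set (measurableTypeR R), measurable A ->
  nu (-%R @^-1` A) = nu A.

Lemma ge0_integral_independentN (f : T * measurableTypeR R -> \bar R) :
  measurable_fun setT f -> (forall z, 0 <= f z) ->
  \int[P]_w f (X w, - Y w)%R = \int[P]_w f (X w, Y w).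
Proof.
move=> mf f0.
have mopp : measurable_fun [set: measurableTypeR R]
    (-%R : measurableTypeR R -> measurableTypeR R).
  exact: oppr_measurable.
have mg : measurable_fun setT (fun z : T * measurableTypeR R => f (z.1, - z.2)%R).
  apply: (measurableT_comp mf); apply: measurable_fun_pair => //.
  exact: measurableT_comp mopp measurable_snd.
rewrite (ge0_integral_independent mg (fun z => f0 _)).
rewrite (ge0_integral_independent mf f0).
apply: eq_integral => x _ /=.
rewrite [RHS](_ : _ = \int[pushforward nu
    (-%R : measurableTypeR R -> measurableTypeR R)]_y f (x, y)); last first.
  by apply: eq_measure_integral => A mA _; exact/esym/nu_sym.
rewrite (ge0_integral_pushforward mopp _ measurableT)//.
by apply: measurableT_comp => //; exact: measurable_pair1.
Qed.

End Independence.

Section Increment.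
Local Open Scope ereal_scope.
Context (R : realType) (dO : measure_display)
  (Omega : measurableType dO) (P : probability Omega R) (s : R) (s0 : s != 0%R).
Local Notation nu := (normal_prob 0 s).
Local Notation rT := (measurableTypeR R).
Variables (S xi Y : Omega -> rT).
Hypotheses (mS : measurable_fun setT S) (mxi : measurable_fun setT xi)
  (mY : measurable_fun setT Y).
Hypothesis XY : forall (A : set (rT * rT)) C, measurable A -> measurable C ->
  P ([set w | A (S w, xi w)] `&` Y @^-1` C) = P [set w | A (S w, xi w)] * nu C.

(** One step of the Ito estimate.  The pair [(S, xi)] is independent of the
    Gaussian increment [Y], so [S + xi * Y] and [S - xi * Y] have the same second
    moment; the parallelogram identity then removes the cross term.  All the
    integrands are nonnegative, so infinite moments cause no difficulty. *)
Lemma second_moment_add_le :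
  \int[P]_w ((S w + xi w * Y w) ^+ 2)%:E <=
  \int[P]_w ((S w) ^+ 2)%:E + (8 * s ^+ 2)%:E * \int[P]_w ((xi w) ^+ 2)%:E.
Proof.
have mX : measurable_fun setT (fun w => (S w, xi w)) by exact: measurable_fun_pair.
pose X : {mfun Omega >-> (rT * rT)%type} := HB.pack (fun w => (S w, xi w))
  (isMeasurableFun.Build _ _ _ _ _ mX).
pose Y' : {mfun Omega >-> rT} := HB.pack Y (isMeasurableFun.Build _ _ _ _ _ mY).
have sq_ge0 (x : R) : 0 <= (x ^+ 2)%:E by rewrite lee_fin sqr_ge0.
have msq (f : Omega -> R) : measurable_fun [set: Omega] (f : Omega -> rT) ->
    measurable_fun setT (fun w => (f w ^+ 2)%:E).
  by move=> mf; apply/measurable_EFinP; exact: measurable_funX.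
have mxiY : measurable_fun setT (fun w => (xi w * Y w)%R : rT) by exact: measurable_funM.
have mD : measurable_fun setT (fun w => (S w + xi w * Y w)%R : rT).
  exact: measurable_funD.
have mB : measurable_fun setT (fun w => (S w - xi w * Y w)%R : rT).
  exact: measurable_funB.
have flip : \int[P]_w ((S w - xi w * Y w) ^+ 2)%:E =
    \int[P]_w ((S w + xi w * Y w) ^+ 2)%:E.
  have := @ge0_integral_independentN R _ _ _ _ P nu X Y' XY
    (normal_prob_opp s0) (fun z => ((z.1.1 + z.1.2 * z.2) ^+ 2)%:E).
  move=> /= <-//.
    by apply: eq_integral => w _; rewrite mulrN.
  apply/measurable_EFinP; apply: measurable_funX; apply: measurable_funD.
    exact: measurableT_comp measurable_fst measurable_fst.
  apply: measurable_funM => //.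
  exact: measurableT_comp measurable_snd measurable_fst.
have E2 : \int[P]_w ((xi w * Y w) ^+ 2)%:E <=
    (8 * s ^+ 2)%:E * \int[P]_w ((xi w) ^+ 2)%:E.
  pose g (z : (rT * rT) * rT) : \bar R := ((z.1.2 * z.2) ^+ 2)%:E.
  have mg : measurable_fun setT g.
    apply/measurable_EFinP; apply: measurable_funX; apply: measurable_funM => //.
    exact: measurableT_comp measurable_snd measurable_fst.
  rewrite (@ge0_integral_independent R _ _ _ _ P nu X Y' XY g mg (fun z => sq_ge0 _)).
  have msnd : measurable_fun [set: rT * rT] (fun z : rT * rT => (z.2 ^+ 2)%:E : \bar R).
    by apply/measurable_EFinP; exact: measurable_funX.
  rewrite [X in _ <= _ * X](_ : _ = \int[distribution P X]_z
      (z.2 ^+ 2)%:E); last by rewrite ge0_integral_distribution.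
  rewrite -ge0_integralZl//; last by rewrite lee_fin mulr_ge0// sqr_ge0.
  have mq : measurable_fun [set: rT] (fun y : rT => (y ^+ 2)%:E : \bar R).
    by apply/measurable_EFinP; exact: measurable_funX.
  apply: ge0_le_integral => //.
  - by move=> z _; apply: integral_ge0 => y _; exact: sq_ge0.
  - apply: (measurable_fun_fubini_tonelli_F g) => // z; exact: sq_ge0.
  - exact: emeasurable_funM.
  - move=> z _; rewrite /g /=.
    under eq_integral do rewrite exprMn EFinM.
    rewrite ge0_integralZl// muleC; apply: lee_wpmul2r => //.
    exact: normal_prob_sqr_le.
have two : \int[P]_w ((S w + xi w * Y w) ^+ 2)%:E + \int[P]_w ((S w - xi w * Y w) ^+ 2)%:E
   = 2%:E * (\int[P]_w ((S w) ^+ 2)%:E + \int[P]_w ((xi w * Y w) ^+ 2)%:E).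
  rewrite -!ge0_integralD//; [|exact: msq..].
  rewrite -ge0_integralZl//.
  - by apply: eq_integral => w _; rewrite -!EFinD -EFinM; congr EFin; ring.
  - by apply: emeasurable_funD; exact: msq.
  - by move=> w _; rewrite adde_ge0.
apply: (@le_trans _ _ (\int[P]_w ((S w) ^+ 2)%:E + \int[P]_w ((xi w * Y w) ^+ 2)%:E)%E).
  by rewrite -(@lee_pmul2l _ 2%:E)// -two flip mule_natl mule2n.
exact: leeD2l.
Qed.

End Increment.

(** * The Ito estimate for elementary processes *)

Section Adapted.
Context (R : realType) (dO : measure_display) (Omega : measurableType dO)
  (T : R) (Filt : R -> set (set Omega)).
Hypothesis hFilt : is_filtration T Filt.
Local Notation rT := (measurableTypeR R).
Implicit Types (t : R) (X : Omega -> R).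

(** Adaptedness as measurability for a generated sigma-algebra, which gives
    access to the closure properties of measurable functions. *)
Lemma measurable_atP t (tT : 0 <= t <= T) X : measurable_at Filt t X <->
  measurable_fun [set: g_sigma_algebraType (Filt t)]
    (X : g_sigma_algebraType (Filt t) -> rT).
Proof.
have [sF _] := hFilt.1 t tT.
have E (A : set (g_sigma_algebraType (Filt t))) : measurable A = Filt t A.
  by rewrite /measurable/= sigma_algebra_id.
split=> [h _ C mC|h C mC].
  by rewrite setTI E; exact: h.
by have := h measurableT C mC; rewrite setTI E.
Qed.

Lemma measurable_at_mono s t X : 0 <= s -> s <= t -> t <= T ->
  measurable_at Filt s X -> measurable_at Filt t X.
Proof. by move=> s0 st tT h C mC; exact: hFilt.2 st tT _ (h C mC). Qed.

Lemma measurable_at_measurable t X : 0 <= t <= T -> measurable_at Filt t X ->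
  measurable_fun setT (X : Omega -> rT).
Proof. by move=> /(hFilt.1 t)[_ sub] h _ C mC; rewrite setTI; apply/sub/h. Qed.

End Adapted.

Section ItoInequality.
Context (R : realType) (dO : measure_display) (Omega : measurableType dO)
  (P : probability Omega R) (T : R) (Filt : R -> set (set Omega)).
Hypothesis hFilt : is_filtration T Filt.
Local Notation rT := (measurableTypeR R).
Context (m : nat) (B : 'I_m -> R -> Omega -> R).
Hypothesis hB : is_brownian P T Filt B.
Variables (t : R) (tT : 0 <= t <= T) (e : elementary R Omega).
Hypothesis he : is_elementary Filt t e.
Variable j : 'I_m.

Let S k w : R :=
  \sum_(i < k) coef e i w * (B j (knot e i.+1) w - B j (knot e i) w).

Lemma knot_le a b : (a <= b)%N -> (b <= nsteps e)%N -> knot e a <= knot e b.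
Proof.
case: he => _ _ hk _; elim: b => [|b IH]; first by rewrite leqn0 => /eqP->.
rewrite leq_eqVlt => /predU1P[->//|]; rewrite ltnS => ab bn.
exact: le_trans (IH ab (ltnW bn)) (hk _ bn).
Qed.

Lemma knot_bounds k : (k <= nsteps e)%N -> 0 <= knot e k <= T.
Proof.
move=> kn; have := knot_le (leq0n _) kn; have := knot_le kn (leqnn _).
case: he => -> -> _ _ k1 k0; rewrite k0/=; apply: le_trans k1 _.
by case/andP: tT.
Qed.

Lemma measurable_at_partial k : (k <= nsteps e)%N ->
  measurable_at Filt (knot e k) (S k).
Proof.
case: (hB) => _ _ Bad _; elim: k => [|k IH] kn.
  apply/(measurable_atP hFilt (knot_bounds kn)).
  rewrite (_ : S 0 = cst 0); last by apply/funext => w; rewrite /S big_ord0.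
  exact: measurable_cst.
have k0 := knot_bounds (ltnW kn); have k1 := knot_bounds kn.
have kk : knot e k <= knot e k.+1 by case: he => _ _ h _; exact: h.
have up (X : Omega -> R) : measurable_at Filt (knot e k) X ->
    measurable_at Filt (knot e k.+1) X.
  by apply: (measurable_at_mono hFilt _ kk); [case/andP: k0|case/andP: k1].
rewrite (_ : S k.+1 = fun w =>
    S k w + coef e k w * (B j (knot e k.+1) w - B j (knot e k) w)); last first.
  by apply/funext => w; rewrite /S big_ord_recr.
apply/(measurable_atP hFilt k1); apply: measurable_funD.
  by apply/(measurable_atP hFilt k1)/up/IH/ltnW.
apply: measurable_funM.
  by apply/(measurable_atP hFilt k1)/up; case: he => _ _ _ h; have [] := h _ kn.
apply: measurable_funB; apply/(measurable_atP hFilt k1); last apply: up; exact: Bad.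
Qed.

(** The increment over a step of zero length vanishes; for the others the partial
    sum and the next coefficient are known at the beginning of the step. *)
Lemma ito_inequality_partial k : (k <= nsteps e)%N ->
  (\int[P]_w ((S k w) ^+ 2)%:E <=
   \sum_(i < k) (8 * (knot e i.+1 - knot e i))%:E * \int[P]_w ((coef e i w) ^+ 2)%:E)%E.
Proof.
case: (hB) => _ _ Bad Binc; elim: k => [|k IH] kn.
  rewrite big_ord0 (eq_integral (cst 0%E)) ?integral0// => w _.
  by rewrite /S big_ord0 expr0n.
have k0 := knot_bounds (ltnW kn); have k1 := knot_bounds kn.
have kk : knot e k <= knot e k.+1 by case: he => _ _ h _; exact: h.
have [cad _] : measurable_at Filt (knot e k) (coef e k) /\
    exists c : R, forall w, `|coef e k w| <= c by case: he => _ _ _ h; exact: h.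
have Sad := measurable_at_partial (ltnW kn).
under eq_integral do rewrite /S big_ord_recr -/(S k _)/=.
rewrite big_ord_recr/=.
have [kkE|kk'] := eqVneq (knot e k) (knot e k.+1).
  rewrite -kkE subrr mulr0 mul0e adde0.
  under eq_integral do rewrite subrr mulr0 addr0.
  exact: IH (ltnW kn).
have {}kk : knot e k < knot e k.+1 by rewrite lt_neqAle kk'.
have d0 : 0 < knot e k.+1 - knot e k by rewrite subr_gt0.
have s0 : Num.sqrt (knot e k.+1 - knot e k) != 0 by rewrite gt_eqF// sqrtr_gt0.
apply: le_trans (leeD2r _ (IH (ltnW kn))).
have {1}-> : knot e k.+1 - knot e k = Num.sqrt (knot e k.+1 - knot e k) ^+ 2.
  by rewrite sqr_sqrtr// ltW.
apply: (second_moment_add_le s0).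
- exact: (measurable_at_measurable hFilt k0 Sad).
- exact: (measurable_at_measurable hFilt k0 cad).
- apply: measurable_funB; first exact: (measurable_at_measurable hFilt k1 (Bad _ _ k1)).
  exact: (measurable_at_measurable hFilt k0 (Bad _ _ k0)).
move=> A C mA mC.
have FA : Filt (knot e k) [set w | A (S k w, coef e k w)].
  have mX : measurable_fun [set: g_sigma_algebraType (Filt (knot e k))]
      (fun w => (S k w, coef e k w) : rT * rT).
    by apply: measurable_fun_pair; apply/(measurable_atP hFilt k0).
  have := mX measurableT A mA; rewrite setTI /measurable/= sigma_algebra_id//.
  by have [] := hFilt.1 _ k0.
(* only the component [j] of the increment is constrained *)
pose Cs i : set rT := if i == j then C else setT.
have mCs i : measurable (Cs i) by rewrite /Cs; case: ifP.
have [/andP[k00 _] /andP[_ k1T]] := conj k0 k1.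
have := Binc _ _ _ Cs k00 kk k1T FA mCs.
rewrite (bigD1 j)//= {2}/Cs eqxx big1; last first.
  by move=> i /negbTE ij; rewrite /Cs ij; exact: probability_setT.
rewrite mule1 => <-; congr (P (_ `&` _)); apply/seteqP; split => w /=.
  by move=> Cw i; rewrite /Cs; case: eqP => // ->.
by move/(_ j); rewrite /Cs eqxx.
Qed.

(** The steps are disjoint, so the square has no cross terms. *)
Lemma elementary_val_sqr (s : R) w : elementary_val e s w ^+ 2 =
  \sum_(k < nsteps e) coef e k w ^+ 2 * \1_`]knot e k, knot e k.+1]%classic s.
Proof.
rewrite /elementary_val.
have disj (i k : 'I_(nsteps e)) : i != k -> s \in `]knot e i, knot e i.+1]%classic ->
    s \notin `]knot e k, knot e k.+1]%classic.
  move=> ik; rewrite !inE/= !in_itv/= => /andP[a1 a2]; apply/negP => /set_mem/=.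
  rewrite in_itv/= => /andP[b1 b2].
  wlog lik : i k ik a1 a2 b1 b2 / (i < k)%N.
    move=> W; have [ltik|ltki|/val_inj eik] := ltngtP i k.
    - exact: (W i k).
    - by apply: (W k i) => //; rewrite eq_sym.
    - by rewrite eik eqxx in ik.
  have := knot_le lik (ltnW (ltn_ord k)).
  by rewrite leNgt (lt_le_trans b1 a2).
have [/existsP[i si]|none] :=
    boolP [exists i : 'I_(nsteps e), s \in `]knot e i, knot e i.+1]%classic].
  rewrite (bigD1 i)//= big1 ?addr0; last first.
    by move=> k ki; rewrite indicE (negbTE (disj i k _ si)) ?mulr0// eq_sym.
  rewrite (bigD1 i)//= big1 ?addr0; last first.
    by move=> k ki; rewrite indicE (negbTE (disj i k _ si)) ?mulr0// eq_sym.
  by rewrite indicE si !mulr1.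
rewrite !big1 ?expr0n//= => i _; rewrite indicE.
  by move/existsPn : none => /(_ i)/negbTE ->; rewrite mulr0.
by move/existsPn : none => /(_ i)/negbTE ->; rewrite mulr0.
Qed.

Lemma integral_elementary_val_sqr w :
  (\int[lebesgue_measure]_(s in `[0%R, t]) (elementary_val e s w ^+ 2)%:E =
   \sum_(k < nsteps e) (knot e k.+1 - knot e k)%:E * (coef e k w ^+ 2)%:E)%E.
Proof.
under eq_integral do rewrite elementary_val_sqr -sumEFin.
rewrite ge0_integral_sum//; last 2 first.
- move=> k; apply/measurable_EFinP; apply: measurable_funM => //.
- by move=> k s _; rewrite lee_fin mulr_ge0 ?sqr_ge0.
apply: eq_bigr => k _.
under eq_integral do rewrite EFinM.
rewrite ge0_integralZl//; last 2 first.
- exact/measurable_EFinP.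
- by rewrite lee_fin sqr_ge0.
rewrite muleC; congr (_ * _)%E.
rewrite integral_indic//.
have [kt0 ktE hk _] := he.
rewrite setIidl; last first.
  move=> s /=; rewrite !in_itv/= => /andP[s1 s2].
  have /andP[k0 _] := knot_bounds (ltnW (ltn_ord k)).
  rewrite (le_trans k0 (ltW s1))/= -ktE (le_trans s2)//.
  exact: knot_le.
rewrite /= lebesgue_measure_itv/= lte_fin; case: ltP => // kk.
by rewrite (le_anti (introT andP (conj (hk _ (ltn_ord k)) kk))) subrr.
Qed.

(** The upper bound of Ito's isometry, up to a constant. *)
Lemma ito_inequality :
  (\int[P]_w ((elementary_int (B j) e w) ^+ 2)%:E <=
   8%:E * \int[P]_w \int[lebesgue_measure]_(s in `[0%R, t])
     (elementary_val e s w ^+ 2)%:E)%E.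
Proof.
apply: le_trans (ito_inequality_partial (leqnn _)) _.
under [X in (_ <= _ * X)%E]eq_integral do rewrite integral_elementary_val_sqr.
have hk k : (k < nsteps e)%N -> 0 <= knot e k.+1 - knot e k.
  by rewrite subr_ge0; case: he => _ _ h _; exact: h.
have mc k : (k < nsteps e)%N -> measurable_fun setT (fun w => (coef e k w ^+ 2)%:E).
  move=> kn; apply/measurable_EFinP; apply: measurable_funX.
  apply: (measurable_at_measurable hFilt (knot_bounds (ltnW kn))).
  by case: he => _ _ _ h; have [] := h _ kn.
rewrite ge0_integral_sum//; last 2 first.
- by move=> k; apply: emeasurable_funM => //; exact: mc.
- by move=> k w _; rewrite -EFinM lee_fin mulr_ge0 ?sqr_ge0 ?hk.
rewrite ge0_sume_distrr; last first.
  by move=> k _; apply: integral_ge0 => w _; rewrite -EFinM lee_fin mulr_ge0 ?sqr_ge0 ?hk.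
apply: lee_sum => k _.
rewrite ge0_integralZl//; last 3 first.
- exact: mc.
- by move=> w _; rewrite lee_fin sqr_ge0.
- by rewrite lee_fin hk.
by rewrite EFinM muleA.
Qed.

End ItoInequality.

(** The integral [I] is the limit of elementary integrals, and these tend to zero
    in L^2 with their integrands, as [I ^+ 2 <= 2 * (E - I) ^+ 2 + 2 * E ^+ 2]. *)
Lemma ito_integral0 (R : realType) (dO : measure_display)
  (Omega : measurableType dO) (P : probability Omega R) (T : R)
  (Filt : R -> set (set Omega)) (m : nat) (B : 'I_m -> R -> Omega -> R)
  (t : R) (H : R -> Omega -> R) (I : Omega -> R) (j : 'I_m) :
  is_filtration T Filt -> is_brownian P T Filt B -> 0 <= t <= T ->
  (forall s w, H s w = 0) -> is_ito_integral P Filt (B j) t H I ->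
  {ae P, forall w, I w = 0}.
Proof.
move=> hFilt hB tT H0 [mI [e [he cval cint]]].
have mE k : measurable_fun setT (elementary_int (B j) (e k) : Omega -> measurableTypeR R).
  apply: (measurable_at_measurable hFilt (knot_bounds tT (he k) (leqnn _))).
  exact: (measurable_at_partial hFilt hB tT (he k)).
have mI2 : measurable_fun setT (fun w => (I w ^+ 2)%:E).
  by apply/measurable_EFinP; exact: measurable_funX.
have I2 : (\int[P]_w (I w ^+ 2)%:E <= 0)%E.
  have c0 : ((fun k => 2%:E * (\int[P]_w ((elementary_int (B j) (e k) w - I w) ^+ 2)%:E)
     + 16%:E * (\int[P]_w \int[lebesgue_measure]_(s in `[0%R, t])
        ((elementary_val (e k) s w - H s w) ^+ 2)%:E)) @ \oo --> 2%:E * 0 + 16%:E * 0)%E.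
    apply: cvgeD.
    - by rewrite !mule0.
    - exact: cvgeZl.
    - exact: cvgeZl.
  move: c0; rewrite !mule0 adde0 => c0; apply: (cvge_to_ge c0).
  apply: nearW => k.
  under [X in (_ <= _ + _ * X)%E]eq_integral => w _ do
    under eq_integral do rewrite H0 subr0.
  rewrite (_ : 16 = 2 * 8 :> R); last by ring.
  rewrite EFinM -muleA.
  apply: le_trans (leeD2l _ (lee_wpmul2l _ (ito_inequality hFilt hB tT (he k) j))) => //.
  have sq0 (x : R) : (0 <= (x ^+ 2)%:E)%E by rewrite lee_fin sqr_ge0.
  have mE2 : measurable_fun setT (fun w => (elementary_int (B j) (e k) w ^+ 2)%:E).
    by apply/measurable_EFinP; apply: measurable_funX; exact: mE.
  have mEI : measurable_fun setT
      (fun w => ((elementary_int (B j) (e k) w - I w) ^+ 2)%:E).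
    apply/measurable_EFinP; apply: measurable_funX.
    by apply: measurable_funB; [exact: mE|exact: mI].
  rewrite -!ge0_integralZl//; [|by move=> w _; exact: sq0..].
  have Z0 (x : R) : (0 <= 2%:E * (x ^+ 2)%:E)%E by rewrite mule_ge0.
  have mZ (f : Omega -> \bar R) : measurable_fun setT f ->
      measurable_fun setT (fun w => 2%:E * f w)%E.
    by move=> mf; exact: emeasurable_funM.
  rewrite -ge0_integralD//; [|exact: mZ..].
  apply: ge0_le_integral => //.
  - by apply: emeasurable_funD; exact: mZ.
  - move=> w _; rewrite -!EFinM -EFinD lee_fin -subr_ge0.
    set a := elementary_int _ _ _; set b := I w.
    rewrite (_ : _ - _ = (2 * a - b) ^+ 2) ?sqr_ge0//; ring.
have /(ae_eq_integral_abs P measurableT mI2) : (\int[P]_w `|(I w ^+ 2)%:E| = 0)%E.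
  under eq_integral do rewrite gee0_abs ?lee_fin ?sqr_ge0//.
  by apply/eqP; rewrite eq_le I2/= integral_ge0// => w _; rewrite lee_fin sqr_ge0.
apply: filterS => w /(_ Logic.I)[] /eqP; rewrite sqrf_eq0 => /eqP.
exact.
Qed.

(** * Conservation of mass *)

Lemma rational_near (R : realType) (T t e : R) : 0 < T -> 0 <= t <= T -> 0 < e ->
  exists q : rat, 0 <= (ratr q : R) <= T /\ `|ratr q - t| < e.
Proof.
move=> T0 /andP[t0 tT] e0.
have lt : Num.max 0 (t - e) < Num.min T (t + e).
  by rewrite lt_min !gt_max T0/=; apply/and3P; split; lra.
have [q] := rat_in_itvoo lt.
rewrite in_itv/= gt_max lt_min => /andP[/andP[q0 qe] /andP[qT qe']].
by exists q; rewrite !ltW//= ltr_distlC; split => //; apply/andP; split; lra.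
Qed.

(** Let [I] be the deviation of the mass at time [t], and [V] the volume of the
    torus.  Young's inequality, for the difference with a rational time so close
    that the squared L^2 norm is less than [k^2 I^2], gives
    [2 k I^2 < k^2 I^2 (1 + V)].  The choice [k = 1 / (1 + V)] makes the
    right-hand side equal to [k I^2], which is absurd. *)
Lemma mass_conserved_path (R : realType) (n : nat) (M : mesh R n) (T m0 : R)
    (u : R -> bscal M) : is_mesh M -> 0 < T -> continuous_path T u ->
  (forall q : rat, 0 <= (ratr q : R) <= T -> torus_int (seval (u (ratr q))) = m0) ->
  forall t, 0 <= t <= T -> torus_int (seval (u t)) = m0.
Proof.
move=> hM T0 cu hq t tT; apply/eqP; apply/negP => /negP tm0.
pose I := m0 - torus_int (seval (u t)).
have I0 : 0 < I ^+ 2 by rewrite exprn_even_gt0//= subr_eq0 eq_sym.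
pose V := torus_int (fun (_ : elt M) _ => 1 : R).
have V0 : 0 <= V by apply: torus_int_ge0.
pose k := (1 + V)^-1.
have k0 : 0 < k by rewrite invr_gt0; lra.
have kV : k * (1 + V) = 1 by rewrite mulVf//; lra.
have aI0 : 0 < k * `|I|.
  by rewrite mulr_gt0// normr_gt0 -sqrf_eq0 gt_eqF.
have [r r0 hr] := cu t tT _ aI0.
have [q [qT qr]] := rational_near T0 tT r0.
have := torus_int_young hM (u (ratr q) - u t) (k * I).
rewrite torus_int_sevalB// hq// -/I -/V.
have : sinner (u (ratr q) - u t) (u (ratr q) - u t) < (k * `|I|) ^+ 2.
  rewrite -[ltLHS]sqr_sqrtr ?sinner_ge0//.
  by rewrite ltr_pXn2r ?nnegrE ?sqrtr_ge0 ?ltW//; exact: hr.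
set S := sinner _ _.
have kk : k ^+ 2 * I ^+ 2 + k ^+ 2 * I ^+ 2 * V = k * I ^+ 2.
  by rewrite -[in RHS](mulr1 k) -kV; ring.
rewrite !exprMn real_normK ?num_real// => ltS leS.
have : 0 < k * I ^+ 2 by rewrite mulr_gt0.
have : 2 * (k * I) * I = 2 * (k * I ^+ 2) by ring.
lra.
Qed.

(* The space dimension is d = n.+1. *)
Theorem proposition4p9 (R : realType) (n : nat) (hn : (n.+1 <= 3)%N)
  (p : nat) (hp : (1 <= p)%N)
  (M : mesh R n) (hM : is_mesh M)
  (sigma tau : R) (hsigma : shape_regular M sigma) (htau : quasi_uniform M tau)
  (hF : facet M -> R) (hhF : facet_length hF)
  (eta : R) (heta : 0 < eta) (N : R) (hN : 0 < N) (T : R) (hT : 0 < T)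
  (nG : nat) (f : 'I_nG -> bvect M) (hf : is_basis p.-1 f)
  (dO : measure_display) (Omega : measurableType dO) (P : probability Omega R)
  (Filt : R -> set (set Omega)) (B : 'I_nG -> R -> Omega -> R)
  (rho0 : bscal M) (hrho0 : Vscal p rho0)
  (rho : R -> Omega -> bscal M)
  (hrho : is_weak_solution P T Filt p eta N hF f B rho0 rho) :
  {ae P, forall w, forall t, 0 <= t <= T ->
    torus_int (seval (rho t w)) = torus_int (seval rho0)}.
Proof.
have [[hFilt hB] _ [hcont _] hweak _] := hrho.
have fixed_t t : 0 <= t <= T ->
    {ae P, forall w, torus_int (seval (rho t w)) = torus_int (seval rho0)}.
  move=> tT; have [I [hI hE]] := hweak _ (@Vscal_const_one _ _ M p) t tT.
  have I0 : {ae P, forall w, forall j, I j w = 0}.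
    apply: filter_forall => j.
    apply: (ito_integral0 hFilt hB tT _ (hI j)) => s w.
    exact: (dgrad_one_orthogonal hM (Vvect_noise_field _ _ hf)).
  apply: filterS2 hE I0 => w.
  rewrite !sinner_one => -> Iw.
  under eq_Rintegral => s _ do rewrite (sip_form_one hM).
  by rewrite /Rintegral integral0/= subr0 big1 ?mulr0 ?addr0.
have all_q : {ae P, forall w, forall q : rat, 0 <= (ratr q : R) <= T ->
    torus_int (seval (rho (ratr q) w)) = torus_int (seval rho0)}.
  (* enumeration of the rationals, to intersect countably many events *)
  have : {ae P, forall w, forall k : nat, if unpickle k is Some q then
     0 <= (ratr (q : rat) : R) <= T ->
     torus_int (seval (rho (ratr q) w)) = torus_int (seval rho0) else True}.
    apply: ae_foralln => k; case: (unpickle k) => [q|]; last exact: aeW.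
    have [qT|qT] := boolP (0 <= (ratr q : R) <= T); last exact: aeW.
    by apply: filterS (fixed_t _ qT) => w.
  by apply: filterS => w h q; have := h (pickle q); rewrite pickleK.
apply: filterS2 hcont all_q => w cw hq.
exact: mass_conserved_path hM hT cw hq.
Qed.
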